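(* Let $\mathfrak{S}$ be an equicontractive RIFS of finite type with associated random self-similar measures $\mu_\omega$. For almost all $\omega\in\Omega$, the set $\mathcal{T}$ of non-essential points in $K_\omega$ has $\mu_\omega$-measure zero.
   Context: Setting. Let $m\ge1$, $\mathcal{A}=\{1,\dots,m\}$, $\Omega=\mathcal{A}^{\mathbb{N}}$, with the Bernoulli product probability measure $\mathbb{P}$ giving weight $\theta_j>0$ to letter $j$, $\sum_j\theta_j=1$; ''almost all'' refers to $\mathbb{P}$. For each $j\in\mathcal{A}$ let $\mathfrak{S}_j=\{S_{j,k}:k\in\mathcal{I}_j\}$, $\mathcal{I}_j=\{0,\dots,\mathcal{N}(j)\}$, with $S_{j,k}(x)=rx+d_{j,k}$ on $\mathbb{R}$ and one common ratio $0<r<1$; $\mathfrak{S}=\{\mathfrak{S}_1,\dots,\mathfrak{S}_m\}$ is an equicontractive RIFS. With $\mathfrak{S}_j(K)=\bigcup_kS_{j,k}(K)$, the attractor is $K_\omega=\lim_n\mathfrak{S}_{\omega_1}\circ\dots\circ\mathfrak{S}_{\omega_n}(K)$ (Hausdorff metric, any non-empty compact $K$). Standing assumption: the convex hull of $K_\omega$ is $[0,1]$ for every $\omega\in\Omega$. Put $\Lambda_{\omega,n}=\{(\sigma_1,\dots,\sigma_n):\sigma_i\in\mathcal{I}_{\omega_i}\}$ and $S_{\omega,\sigma}=S_{\omega_1,\sigma_1}\circ\dots\circ S_{\omega_n,\sigma_n}$. Measures: fix $p_{j,k}>0$ with $\sum_{k\in\mathcal{I}_j}p_{j,k}=1$ for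 each $j$. $\mu_\omega$ are the unique Borel probability measures supported on $K_\omega$ with $\mu_\omega(E)=\sum_{k\in\mathcal{I}_{\omega_1}}p_{\omega_1,k}\mu_{\omega_2\omega_3\dots}(S_{\omega_1,k}^{-1}(E))$ for Borel $E$. Finite type: there is a finite set $F$ such that for all $n\in\mathbb{N}$, $\omega\in\Omega$, $\sigma,\tau\in\Lambda_{\omega,n}$, either $|S_{\omega,\sigma}(0)-S_{\omega,\tau}(0)|r^{-n}>1$ or $(S_{\omega,\sigma}(0)-S_{\omega,\tau}(0))r^{-n}\in F$. Net intervals: for $n\ge1$ let $h_1<\dots<h_{s_n}$ be the elements of $\{S_{\omega,\sigma}(z):z\in\{0,1\},\sigma\in\Lambda_{\omega,n}\}$; the $\omega$-net intervals of level $n$ are the $[h_i,h_{i+1}]$ with $(h_i,h_{i+1})\cap K_\omega\neq\emptyset$; $[0,1]$ is the only net interval of level $0$. Each net interval $\Delta$ of level $n\ge1$ lies in a unique net interval of level $n-1$, its parent ($\Delta$ is its child). For $\Delta=[a,b]$ of level $n$: normalized length $\ell_n(\Delta)=r^{-n}(b-a)$; neighbour set $V_n^\omega(\Delta)=(a_1,\dots,a_J)$, the increasing list of the distinct numbers $r^{-n}(a-S_{\omega,\sigma}(0))$ over $\sigma\in\Lambda_{\omega,n}$ with $\Delta\subseteq S_{\omega,\sigma}([0,1])$; $t_n(\Delta)=t$ if $\Delta$ is the $t$-th from the left among the children of its parent having the same normalized length and neighbour set as $\Delta$ (and $t_0([0,1])=1$). The characteristic vector of $\Delta$ is $(\ell_n(\Delta),V_n^\omega(\Delta),t_n(\Delta))$.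 An $\omega$-symbolic representation of $x\in K_\omega$ is $[x]_\omega=(\gamma_0,\gamma_1,\dots)$, the characteristic vectors of a sequence $\Delta_0=[0,1]\supseteq\Delta_1\supseteq\dots$ with $x\in\Delta_n$, $\Delta_n$ an $\omega$-net interval of level $n$, $\Delta_{n-1}$ the parent of $\Delta_n$. Paths: for $\nu=(\nu_1,\dots,\nu_k)\in\mathcal{A}^k$, a sequence of characteristic vectors $\gamma=\gamma_0,\dots,\gamma_k=\beta$ is an admissible $\nu$-path linking $\gamma$ to $\beta$ if there are $\omega\in\Omega$ and $N$ with $\omega_{N+i}=\nu_i$ for $i=1,\dots,k$, and $\omega$-net intervals $\Delta_i$ of level $N+i$ ($i=0,\dots,k$) with characteristic vectors $\gamma_i$ such that each $\Delta_i$ is a child of $\Delta_{i-1}$. An admissible path is an admissible $\nu$-path for some finite word $\nu$; $\beta$ is a child of $\gamma$ if there is an admissible path of length one linking $\gamma$ to $\beta$. Essential class: a non-empty set $\mathcal{L}$ of characteristic vectors is a loop class if for all $\gamma,\beta\in\mathcal{L}$ there is an admissible path linking $\gamma$ to $\beta$ with all its vectors in $\mathcal{L}$; it is an essential class if moreover every child of every member of $\mathcal{L}$ is in $\mathcal{L}$. There is exactly one essential class, denoted $\mathcal{E}$. A point $x\in K_\omega$ is an essential point if it has an $\omega$-symbolic representation $(\gamma_0,\gamma_1,\dots)$ for which there is some $J$ with $\gamma_j\in\mathcal{E}$ for all $j\ge J$; otherwise it is non-essential. *)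

(* Defs.v *)
From HB Require Import structures.
From mathcomp Require Import all_boot all_order all_algebra.
From mathcomp Require Import all_classical all_reals all_analysis.

Set Implicit Arguments.
Unset Strict Implicit.
Unset Printing Implicit Defensive.

Import Order.TTheory GRing.Theory Num.Theory.
Import numFieldNormedType.Exports.

Local Open Scope classical_set_scope.
Local Open Scope ring_scope.

(* The alphabet is 'I_m.+1 with m the field below, so it is never empty; the
   j-th IFS consists of the (nmax j).+1 maps x |-> ratio * x + trans k. *)
Record rifs (R : realType) := Rifs {
  nletter : nat;
  nmax : 'I_nletter.+1 -> nat;
  ratio : R;
  trans : forall j : 'I_nletter.+1, 'I_(nmax j).+1 -> R;
  ratio_itv : 0 < ratio < 1
}.

Section convex_hausdorff.
Context {R : realType}.
Implicit Types A B : set R.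

Definition convex_hull A : set R := smallest (@convex_set R R^o) A.

Definition fattening (e : R) A : set R :=
  [set x | exists2 a, A a & `|x - a| <= e].

Definition hausdorff_dist A B : R :=
  inf [set e | [/\ 0 <= e, A `<=` fattening e B & B `<=` fattening e A]].

End convex_hausdorff.

Section random_ifs.
Context {R : realType} (S : rifs R).

Definition letter : Type := 'I_(nletter S).+1.

HB.instance Definition _ := Finite.on letter.
HB.instance Definition _ := isPointed.Build letter ord0.

Definition index_set (j : letter) := 'I_(nmax j).+1.

(* omega_1 omega_2 ... is coded by omega 0, omega 1, ... *)
Definition Omega : Type := nat -> letter.

HB.instance Definition _ := Pointed.on Omega.

Definition shift (w : Omega) : Omega := fun i => w i.+1.

Definition cylinder (u : seq letter) : set Omega :=
  [set w | mkseq w (size u) = u].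

Definition sequence_space : Type := g_sigma_algebraType (range cylinder).

(* By uniqueness of extension these values determine P. *)
Definition is_bernoulli (theta : letter -> R)
    (P : probability sequence_space R) : Prop :=
  forall u : seq letter, P (cylinder u) = (\prod_(j <- u) theta j)%:E.

Definition sim (j : letter) (k : index_set j) (x : R) : R :=
  ratio S * x + trans k.

Definition ifs_image (j : letter) (C : set R) : set R :=
  \bigcup_(k : index_set j) (sim k @` C).

Fixpoint ifs_iter (w : Omega) (n : nat) (C : set R) : set R :=
  if n is n'.+1 then ifs_image (w 0%N) (ifs_iter (shift w) n' C) else C.

Definition is_attractor (w : Omega) (K : set R) : Prop :=
  [/\ compact K, K !=set0
    & forall C : set R, compact C -> C !=set0 ->
        (fun n => hausdorff_dist (ifs_iter w n C) K) @ \oo --> (0 : R)].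

Definition attractor (w : Omega) : set R := xget set0 (is_attractor w).

Definition indexed_letter := {j : letter & index_set j}.

(* The words of Lambda_{w,n}, every entry sigma_i carrying its letter w_i. *)
Fixpoint words (w : Omega) (n : nat) : seq (seq indexed_letter) :=
  if n is n'.+1 then
    [seq existT index_set (w 0%N) k :: s
       | k <- enum (index_set (w 0%N)), s <- words (shift w) n']
  else [:: [::]].

Definition word_map (s : seq indexed_letter) : R -> R :=
  foldr (fun a f => sim (tagged a) \o f) id s.

Definition finite_type : Prop :=
  exists F : seq R, forall (n : nat) (w : Omega) (s t : seq indexed_letter),
    s \in words w n -> t \in words w n ->
    `|word_map s 0 - word_map t 0| * ratio S ^- n > 1 \/
    (word_map s 0 - word_map t 0) * ratio S ^- n \in F.

Definition is_random_self_similar (p : forall j, index_set j -> R)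
    (mu : Omega -> probability (measurableTypeR R) R) : Prop :=
  forall w : Omega,
    mu w (~` attractor w) = 0%E /\
    forall E : set (measurableTypeR R), measurable E ->
      mu w E = (\sum_(k : index_set (w 0%N))
                  (p (w 0%N) k)%:E * mu (shift w) (sim k @^-1` E))%E.

(* An interval [a, b] is represented by the pair (a, b). *)
Definition citv (D : R * R) : set R := `[D.1, D.2]%classic.

Definition endpoints (w : Omega) (n : nat) : seq R :=
  sort <=%R (undup [seq word_map s z | s <- words w n, z <- [:: 0; 1]]).

(* Listed from left to right. *)
Definition net_intervals (w : Omega) (n : nat) : seq (R * R) :=
  if n is 0%N then [:: (0, 1)] else
  [seq D <- zip (endpoints w n) (behead (endpoints w n))
     | `[< `]D.1, D.2[%classic `&` attractor w !=set0 >]].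

Definition children (w : Omega) (n : nat) (D : R * R) : seq (R * R) :=
  [seq D' <- net_intervals w n.+1 | `[< citv D' `<=` citv D >]].

(* For D of level n.+1: the net interval of level n that contains D. *)
Definition parent (w : Omega) (n : nat) (D : R * R) : R * R :=
  head (0, 1) [seq D' <- net_intervals w n | `[< citv D `<=` citv D' >]].

Definition normalized_length (n : nat) (D : R * R) : R :=
  ratio S ^- n * (D.2 - D.1).

Definition neighbour_set (w : Omega) (n : nat) (D : R * R) : seq R :=
  sort <=%R (undup [seq ratio S ^- n * (D.1 - word_map s 0)
    | s <- words w n & `[< citv D `<=` word_map s @` `[0, 1]%classic >]]).

Definition sibling_rank (w : Omega) (n : nat) (D : R * R) : nat :=
  if n is n'.+1 then
    (index D [seq D' <- children w n' (parent w n' D)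
       | (normalized_length n D' == normalized_length n D) &&
         (neighbour_set w n D' == neighbour_set w n D)]).+1
  else 1%N.

Definition charvec : Type := (R * seq R * nat)%type.

Definition charvec_of (w : Omega) (n : nat) (D : R * R) : charvec :=
  (normalized_length n D, neighbour_set w n D, sibling_rank w n D).

Definition symbolic_representation (w : Omega) (x : R) (g : nat -> charvec)
    : Prop :=
  exists D : nat -> R * R,
    [/\ D 0%N = (0, 1),
        forall n, D n \in net_intervals w n /\ citv (D n) x,
        forall n, D n.+1 \in children w n (D n)
      & forall n, g n = charvec_of w n (D n)].

Definition admissible_path (nu : seq letter) (g : seq charvec) : Prop :=
  exists (w : Omega) (N : nat) (D : nat -> R * R),
    [/\ mkseq (fun i => w (N + i)%N) (size nu) = nu,
        mkseq (fun i => charvec_of w (N + i) (D i)) (size nu).+1 = g,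
        forall i, (i <= size nu)%N -> D i \in net_intervals w (N + i)
      & forall i, (i < size nu)%N -> D i.+1 \in children w (N + i) (D i)].

Definition child (g b : charvec) : Prop :=
  exists j : letter, admissible_path [:: j] [:: g; b].

Definition loop_class (L : set charvec) : Prop :=
  L !=set0 /\
  forall g b, L g -> L b ->
    exists (nu : seq letter) (s : seq charvec),
      [/\ (0 < size nu)%N, admissible_path nu (g :: s), last g s = b
        & {in g :: s, forall c, L c}].

Definition is_essential_class (L : set charvec) : Prop :=
  loop_class L /\ forall g b, L g -> child g b -> L b.

(* A RIFS of finite type has exactly one essential class. *)
Definition essential_class : set charvec := xget set0 is_essential_class.

Definition essential_point (w : Omega) (x : R) : Prop :=
  exists2 g : nat -> charvec, symbolic_representation w x g &
    exists J : nat, forall j, (J <= j)%N -> essential_class (g j).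

Definition nonessential_points (w : Omega) : set R :=
  [set x | attractor w x /\ ~ essential_point w x].

End random_ifs.

(* Main.v *)
Require Import Defs.
From HB Require Import structures.
From mathcomp Require Import all_boot all_order all_algebra.
From mathcomp Require Import all_classical all_reals all_analysis.
From mathcomp Require Import measurable_realfun.
From mathcomp Require Import ring lra zify.

Set Implicit Arguments.
Unset Strict Implicit.
Unset Printing Implicit Defensive.

Import Order.TTheory GRing.Theory Num.Theory.
Import numFieldNormedType.Exports.
Import Defs.

Local Open Scope classical_set_scope.
Local Open Scope ring_scope.

(** The almost sure statement rests on one finite word, the marker.

    Finite type bounds the sizes of the neighbour sets, so some net interval
    [D], of level [n] for a sequence [w0], has a neighbour set of the largest
    possible size ([crowded_exists]).  Let [s] be a word of length [N] for [w]
    whose letters are followed in [w] by the first letters of [w0].  The copy of [D] under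
    [word_map s] is covered by the copies of all the neighbours of [D].  An
    endpoint of level [N + n] inside the copy would bring a further neighbour
    to a smaller net interval next to it, because the attractor comes
    arbitrarily close to both ends of every basic interval from inside; this
    contradicts maximality.  Hence the copy is a net interval with the length
    and the neighbour set of [D] ([crowded_image]).

    The children of a net interval depend on its length, its neighbour set and
    the next letter, except that the letters still to come decide which
    candidates meet the attractor.  The latter condition depends only on the
    length and the neighbour set of the candidate, so the siblings counted by
    the sibling rank appear or disappear all together, and the characteristic vector
    of a child that does occur is determined by the past ([transfer],
    [prefix_change]).  It follows that admissible paths can be concatenated
    ([linked_trans]), and that the copy of a child [D1] of [D] has one and the
    same characteristic vector [b] wherever the letters of [w0] occur.  A longer
    block [m] of letters of [w0], carried by a basic interval inside [D1], makes
    this independent of the letters that come after ([marker_exists]).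

    Every net interval contains basic intervals, after which the letters of [m]
    may be prescribed, so every characteristic vector leads to [b].  This alone
    makes the set of vectors reachable from [b] the only essential class
    ([essential_classE]), and every point whose coding contains [m] is an
    essential point ([marker_essential]).

    Almost surely the letters of [m] occur infinitely often in [w]
    ([recurrence]).  For such a [w], self-similarity of [mu] shows that each
    occurrence leaves at most the proportion [1 - word_weight m] of the mass
    away from the basic intervals coded by [m], so that this mass is zero
    ([unmarked_null]). *)

(** * Words and similarities *)

Section similarities.
Context {R : realType} (S : rifs R).
Implicit Types (w : Omega S) (s t u : seq (indexed_letter S)).

Lemma ratio_gt0 : 0 < ratio S.
Proof. by case/andP: (ratio_itv S). Qed.

Lemma ratio_lt1 : ratio S < 1.
Proof. by case/andP: (ratio_itv S). Qed.

Lemma ratioX_gt0 n : 0 < ratio S ^+ n.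
Proof. exact/exprn_gt0/ratio_gt0. Qed.

Lemma ratioX_neq0 n : ratio S ^+ n != 0.
Proof. exact/lt0r_neq0/ratioX_gt0. Qed.

Lemma ratioX_le1 n : ratio S ^+ n <= 1.
Proof. by rewrite exprn_ile1 // ltW ?ratio_gt0 ?ratio_lt1. Qed.

Lemma ratioX_lt (e : R) n : 0 < e -> exists2 m, (n <= m)%N & ratio S ^+ m < e.
Proof.
move=> e0.
have : (fun k => ratio S ^+ k) @ \oo --> (0 : R).
  by apply: cvg_expr; rewrite ger0_norm ?ratio_lt1 // ltW // ratio_gt0.
move/cvgrPdist_lt => /(_ e e0) [N _ /(_ (maxn n N) (leq_maxr _ _))] /=.
rewrite sub0r normrN ger0_norm ?(ltW (ratioX_gt0 _)) // => h.
by exists (maxn n N) => //; exact: leq_maxl.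
Qed.

Lemma simE (j : letter S) (k : index_set j) x : sim k x = ratio S * x + trans k.
Proof. by []. Qed.

Lemma word_map_cons a s x : word_map (a :: s) x = sim (tagged a) (word_map s x).
Proof. by []. Qed.

Lemma word_map_cat s t x : word_map (s ++ t) x = word_map s (word_map t x).
Proof. by elim: s => //= a s IH; rewrite /= IH. Qed.

Lemma word_mapE s x : word_map s x = ratio S ^+ size s * x + word_map s 0.
Proof.
elim: s x => [|a s IH] x; first by rewrite expr0 mul1r addr0.
by rewrite !word_map_cons !simE (IH x) mulrDr mulrA -exprS addrA.
Qed.

Lemma word_map_le s x y : (word_map s x <= word_map s y) = (x <= y).
Proof. by rewrite (word_mapE s x) (word_mapE s y) lerD2r ler_pM2l ?ratioX_gt0. Qed.

Lemma word_map_lt s x y : (word_map s x < word_map s y) = (x < y).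
Proof. by rewrite (word_mapE s x) (word_mapE s y) ltrD2r ltr_pM2l ?ratioX_gt0. Qed.

Definition tail n w : Omega S := iter n (@shift R S) w.

Lemma tailE n w i : tail n w i = w (n + i)%N.
Proof. by elim: n i => //= n IH i; rewrite /shift IH addSnnS. Qed.

Lemma tail_shift n w : tail n (shift w) = tail n.+1 w.
Proof. by rewrite /tail iterSr. Qed.

Lemma tailD n m w : tail m (tail n w) = tail (n + m) w.
Proof. by rewrite /tail addnC iterD. Qed.

Lemma mkseqS w n : mkseq w n.+1 = w 0%N :: mkseq (shift w) n.
Proof.
by rewrite /mkseq /= (iotaDl 1 0 n) -map_comp.
Qed.

Lemma mkseqD w n m : mkseq w (n + m) = mkseq w n ++ mkseq (tail n w) m.
Proof.
by elim: n w => [//|n IH] w; rewrite addSn !mkseqS IH tail_shift.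
Qed.

Lemma eq_mkseqP w w' n :
  mkseq w n = mkseq w' n <-> forall i, (i < n)%N -> w i = w' i.
Proof.
split=> [h i ltin|h].
  by rewrite -(nth_mkseq (w 0%N) w ltin) h nth_mkseq.
apply: (@eq_from_nth _ (w 0%N)); first by rewrite !size_mkseq.
by move=> i; rewrite size_mkseq => lti; rewrite !nth_mkseq // h.
Qed.

(** Words depend on a finite prefix only, and all later manipulations of
    words go through this equation between sequences of letters. *)
Lemma mem_words w n s : (s \in words w n) = (map tag s == mkseq w n).
Proof.
elim: n w s => [|n IH] w s /=; first by case: s.
rewrite mkseqS; case: s => [|[j k] s] /=.
  rewrite -[RHS]/false; apply/negP => /allpairsPdep[k [s [_ _ h]]].
  by discriminate h.
rewrite eqseq_cons -IH.
apply/allpairsPdep/andP => [[k' [s' [_ s'w [jE _ ->]]]]|]; first by split=> //; apply/eqP.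
move=> [/eqP /= jE sw]; subst j; exists k, s; split=> //.
by rewrite mem_enum.
Qed.

Lemma wordsP w n s : s \in words w n -> map tag s = mkseq w n.
Proof. by rewrite mem_words => /eqP. Qed.

Lemma size_words w n s : s \in words w n -> size s = n.
Proof. by move/wordsP/(congr1 size); rewrite size_map size_mkseq. Qed.

Lemma words_cat w n m s t :
  s \in words w n -> t \in words (tail n w) m -> s ++ t \in words w (n + m).
Proof. by rewrite !mem_words map_cat mkseqD => /eqP -> /eqP ->. Qed.

Lemma words_split w n m s : s \in words w (n + m) ->
  take n s \in words w n /\ drop n s \in words (tail n w) m.
Proof.
rewrite !mem_words map_take map_drop => /eqP ->; rewrite mkseqD.
by rewrite take_size_cat ?drop_size_cat ?size_mkseq.
Qed.

Lemma words_prefix w w' n : mkseq w n = mkseq w' n -> words w n =i words w' n.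
Proof. by move=> h s; rewrite !mem_words h. Qed.

End similarities.

(** * The attractor is self-similar and contains 0 and 1 *)

Lemma interval_convex (R : realType) (A : set R) :
  is_interval A -> @convex_set R R^o A.
Proof.
move=> iA x y l /set_mem Ax /set_mem Ay; apply/mem_set.
wlog xy : x y l Ax Ay / x <= y.
  move=> h; have [xy|/ltW yx] := leP x y; first exact: h.
  by rewrite convC; exact: h.
have := convR_itv l xy; rewrite in_itv /= => h.
exact: (iA x y).
Qed.

Section attractor.
Context {R : realType} (S : rifs R).
Implicit Types (w : Omega S) (s t u : seq (indexed_letter S)) (x y z : R).
Context (hull01 : forall w, convex_hull (attractor w) = `[0, 1]%classic).

(** The choice made by [attractor] succeeds: a failing choice would give the
    empty set, whose convex hull is not [0, 1]. *)
Lemma attractorP w : is_attractor w (attractor w).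
Proof.
rewrite /attractor; case: xgetP => // nK.
have := hull01 w; rewrite /attractor xgetPN; last first.
  by move=> K hK; exact: (nK K hK).
move=> h; exfalso.
have : convex_hull (@set0 R) 0 by rewrite h /= in_itv /= lexx ler01.
suff : convex_hull (@set0 R) `<=` set0 by apply.
by apply: smallest_sub => //; apply: interval_convex => x y [].
Qed.

Lemma attractor_compact w : compact (attractor w).
Proof. by case: (attractorP w). Qed.

Lemma attractor_closed w : closed (attractor w).
Proof. by apply: compact_closed; [exact: Rhausdorff|exact: attractor_compact]. Qed.

(** Order-convex sets are convex, so they contain the hull.  Applied to
    open half-lines, this puts 0 and 1 into the attractor. *)
Lemma hull_sub w (A : set R) : is_interval A -> attractor w `<=` A ->
  forall x, 0 <= x <= 1 -> A x.
Proof.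
move=> iA KA x x01; have : convex_hull (attractor w) x.
  by rewrite hull01 /= in_itv.
by apply: smallest_sub => //; exact: interval_convex.
Qed.

Lemma attractor01 w x : attractor w x -> 0 <= x <= 1.
Proof.
move=> Kx; have : convex_hull (attractor w) x.
  exact: (@sub_gen_smallest _ _ (attractor w) x Kx).
by rewrite hull01 /= in_itv.
Qed.

Lemma attractor_0 w : attractor w 0.
Proof.
apply: contrapT => nK0; suff : [set x : R | 0 < x] 0 by rewrite /= ltxx.
apply: (@hull_sub w [set x : R | 0 < x]); last by rewrite lexx ler01.
- by move=> x y /= x0 _ z /andP[xz _]; exact: lt_le_trans x0 xz.
- move=> x Kx /=; have /andP[x0 _] := attractor01 Kx.
  by rewrite lt_neqAle x0 andbT; apply/eqP => x0E; apply: nK0; rewrite x0E.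
Qed.

Lemma attractor_1 w : attractor w 1.
Proof.
apply: contrapT => nK1; suff : [set x : R | x < 1] 1 by rewrite /= ltxx.
apply: (@hull_sub w [set x : R | x < 1]); last by rewrite lexx ler01.
- by move=> x y /= _ y1 z /andP[_ zy]; exact: le_lt_trans zy y1.
- move=> x Kx /=; have /andP[_ x1] := attractor01 Kx.
  by rewrite lt_neqAle x1 andbT; apply/eqP => x1E; apply: nK1; rewrite -x1E.
Qed.

Lemma ifs_iter_bounded w n :
  exists M : R, forall x, ifs_iter w n [set 0] x -> `|x| <= M.
Proof.
elim: n w => [|n IH] w /=.
  by exists 0 => x ->; rewrite normr0.
have [M hM] := IH (shift w).
exists (ratio S * M + \sum_(k : index_set (w 0%N)) `|trans k|) => x.
move=> [k _ [y /hM yM <-]].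
rewrite simE (le_trans (ler_normD _ _)) // lerD //.
  by rewrite normrM gtr0_norm ?ratio_gt0 // ler_pM2l ?ratio_gt0.
by rewrite (bigD1 k) //= lerDl sumr_ge0.
Qed.

Lemma ifs_iter_nonempty w n : ifs_iter w n [set (0 : R)] !=set0.
Proof.
elim: n w => [|n IH] w /=; first by exists 0.
have [y hy] := IH (shift w).
by exists (@sim _ _ (w 0%N) ord0 y), ord0 => //; exists y.
Qed.

(** Smallness of the infimum in [hausdorff_dist] says something only when the
    set of admissible fattenings is nonempty, hence the bound on the finite
    sets [ifs_iter w n [set 0]]. *)
Lemma attractor_approx w (e : R) : 0 < e -> exists N, forall n, (N <= n)%N ->
  ifs_iter w n [set 0] `<=` fattening e (attractor w) /\
  attractor w `<=` fattening e (ifs_iter w n [set 0]).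
Proof.
move=> e0; have [_ [a Ka]] := attractorP w.
move/(_ [set 0] (@compact_set1 _ 0) (ex_intro _ 0 erefl)).
move/cvgrPdist_lt => /(_ e e0) [N _ h]; exists N => n Nn.
have {h} := h n Nn; rewrite /= sub0r normrN => /ltr_normlW.
rewrite /hausdorff_dist => /inf_lt; case.
  have [M hM] := ifs_iter_bounded w n.
  have [b Ab] := ifs_iter_nonempty w n.
  have M0 : 0 <= M by rewrite (le_trans _ (hM _ Ab)).
  exists (M + 1); split; first by rewrite addr_ge0.
  - move=> x /hM xM; exists a => //.
    rewrite (le_trans (ler_normB _ _)) // lerD //.
    by have /andP[a0 a1] := attractor01 Ka; rewrite ger0_norm.
  - move=> x /attractor01 /andP[x0 x1]; exists b => //.
    rewrite (le_trans (ler_normB _ _)) // addrC lerD // ?hM //.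
    by rewrite ger0_norm.
move=> e' [e'0 h1 h2] /ltW e'e; split=> x.
- by move=> /h1 [y Ky xy]; exists y => //; exact: le_trans e'e.
- by move=> /h2 [y Ky xy]; exists y => //; exact: le_trans e'e.
Qed.

Lemma closed_approx (A : set R) x : closed A ->
  (forall e : R, 0 < e -> exists2 y, A y & `|x - y| <= e) -> A x.
Proof.
move=> cA h; apply: cA => U /nbhs_ballP[e /= e0 eU].
have e20 : 0 < e / 2 by rewrite divr_gt0.
have [y Ay xy] := h _ e20.
exists y; split => //; apply: eU; rewrite /ball /=.
by rewrite (le_lt_trans xy) // ltr_pdivrMr // ltr_pMr // ltr1n.
Qed.

Lemma sim_dist (j : letter S) (k : index_set j) x y :
  `|sim k x - sim k y| = ratio S * `|x - y|.
Proof.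
by rewrite !simE opprD addrACA subrr addr0 -mulrBr normrM gtr0_norm ?ratio_gt0.
Qed.

Lemma sim_image_closed (j : letter S) (k : index_set j) (A : set R) :
  compact A -> closed (sim k @` A).
Proof.
move=> cA; apply: compact_closed; first exact: Rhausdorff.
apply: continuous_compact => //.
apply/continuous_subspaceT => x; apply: cvgD; last exact: cvg_cst.
by apply: cvgM; [exact: cvg_cst|exact: cvg_id].
Qed.

(** One step of the iteration along [w] is the image of the iteration along
    [shift w], so both closed sets have the same approximations. *)
Lemma attractor_ifs w :
  attractor w = ifs_image (w 0%N) (attractor (shift w)).
Proof.
apply/seteqP; split => x.
- move=> Kx.
  have cI : closed (ifs_image (w 0%N) (attractor (shift w))).
    apply: closed_bigcup => [|k _]; first exact: finite_finset.
    exact/sim_image_closed/attractor_compact.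
  apply: closed_approx => // e e0.
  have e20 : 0 < e / 2 by rewrite divr_gt0.
  have [N1 h1] := attractor_approx w e20.
  have [N2 h2] := attractor_approx (shift w) e20.
  have [_ /(_ x Kx) [y [k _ [z Az <-]] xy]] :=
    h1 (maxn N1 N2).+1 (leqW (leq_maxl _ _)).
  have [/(_ z Az) [v Kv zv] _] := h2 _ (leq_maxr N1 N2).
  exists (sim k v); first by exists k => //; exists v.
  rewrite -(subrKA (sim k z)) (le_trans (ler_normD _ _)) // (splitr e) lerD //.
  rewrite sim_dist (le_trans _ zv) // ler_piMl // ?ltW ?ratio_lt1 //.
- move=> [k _ [y Ky <-]].
  apply: closed_approx; first exact: attractor_closed.
  move=> e e0.
  have e20 : 0 < e / 2 by rewrite divr_gt0.
  have [N1 h1] := attractor_approx w e20.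
  have [N2 h2] := attractor_approx (shift w) e20.
  have [/(_ _) h3 _] := h1 (maxn N1 N2).+1 (leqW (leq_maxl _ _)).
  have [_ /(_ y Ky) [v Av yv]] := h2 _ (leq_maxr N1 N2).
  have [|z Kz vz] := h3 (sim k v); first by exists k => //; exists v.
  exists z => //.
  rewrite -(subrKA (sim k v)) (le_trans (ler_normD _ _)) // (splitr e) lerD //.
  rewrite sim_dist (le_trans _ yv) // ler_piMl // ?ltW ?ratio_lt1 //.
Qed.

End attractor.

(** * Coding of the attractor and one-sided approximation *)

Section attractor_words.
Context {R : realType} (S : rifs R).
Implicit Types (w : Omega S) (s t u : seq (indexed_letter S)) (x y z : R).
Context (hull01 : forall w, convex_hull (attractor w) = `[0, 1]%classic).

Lemma attractor_word w n s y :
  s \in words w n -> attractor (tail n w) y -> attractor w (word_map s y).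
Proof.
elim: n w s => [|n IH] w s /=; first by rewrite inE => /eqP ->.
move=> /allpairsPdep[k [s' [_ s'w ->]]] Ky /=.
rewrite (attractor_ifs hull01); exists k => //; exists (word_map s' y) => //.
by apply: IH => //; rewrite tail_shift.
Qed.

Lemma attractor_decomp w n x : attractor w x ->
  exists2 s, s \in words w n &
    exists2 y, attractor (tail n w) y & x = word_map s y.
Proof.
elim: n w x => [|n IH] w x Kx; first by exists [::] => //; exists x.
move: Kx; rewrite (attractor_ifs hull01) => -[k _ [z /IH[s sw [y Ky ->]] <-]].
exists (existT _ (w 0%N) k :: s).
  by apply/allpairsPdep; exists k, s; rewrite mem_enum.
by exists y => //; rewrite -tail_shift.
Qed.

Lemma word_map_itv w n s x :
  s \in words w n -> 0 <= x <= 1 -> 0 <= word_map s x <= 1.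
Proof.
move=> sw /andP[x0 x1].
have /andP[a0 _] := attractor01 hull01
  (attractor_word sw (attractor_0 hull01 _)).
have /andP[_ a1] := attractor01 hull01
  (attractor_word sw (attractor_1 hull01 _)).
apply/andP; split.
  by apply: le_trans a0 _; rewrite word_map_le.
by apply: le_trans a1; rewrite word_map_le.
Qed.

(** The coding of the point 0: a word that moved 0 to the right would move
    the whole of [0, 1] away from 0.  As a consequence, endpoints of one level
    are endpoints of the next one. *)
Lemma word_fix0 w n : exists2 s, s \in words w n & word_map s 0 = 0.
Proof.
have [s sw [y /(attractor01 hull01) /andP[y0 _] yE]] :=
  attractor_decomp n (attractor_0 hull01 w).
exists s => //; apply/eqP; rewrite eq_le; apply/andP; split.
  by rewrite [leRHS]yE word_map_le.
have /andP[] // : 0 <= word_map s 0 <= 1.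
by apply: (word_map_itv sw); rewrite lexx ler01.
Qed.

Lemma word_fix1 w n : exists2 s, s \in words w n & word_map s 1 = 1.
Proof.
have [s sw [y /(attractor01 hull01) /andP[_ y1] yE]] :=
  attractor_decomp n (attractor_1 hull01 w).
exists s => //; apply/eqP; rewrite eq_le; apply/andP; split; last first.
  by rewrite [leLHS]yE word_map_le.
have /andP[] // : 0 <= word_map s 1 <= 1.
by apply: (word_map_itv sw); rewrite lexx ler01.
Qed.

(** Accumulation from one side is what survives subdivision: the net
    interval on that side of the point meets the attractor at every level. *)
Definition right_limit (A : set R) x :=
  forall e : R, 0 < e -> exists2 y, A y & x < y < x + e.

Definition left_limit (A : set R) x :=
  forall e : R, 0 < e -> exists2 y, A y & x - e < y < x.

Lemma word_map1 w n s :
  s \in words w n -> word_map s 1 = word_map s 0 + ratio S ^+ n.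
Proof. by move=> sw; rewrite word_mapE mulr1 (size_words sw) addrC. Qed.

(** The images of 1 under the words that fix 0 decrease to 0. *)
Lemma attractor_right_limit0 w n s :
  s \in words w n -> right_limit (attractor w) (word_map s 0).
Proof.
move=> sw e e0; have [m _ me] := ratioX_lt S 0 e0.
have [t tw t0] := word_fix0 (tail n w) m.
exists (word_map (s ++ t) 1).
  exact: (attractor_word (words_cat sw tw) (attractor_1 hull01 _)).
rewrite (word_map1 (words_cat sw tw)) word_map_cat t0 ltrDl ratioX_gt0.
rewrite ltrD2l (le_lt_trans _ me) //.
by rewrite exprD ler_piMl ?ratioX_le1 ?(ltW (ratioX_gt0 _ _)).
Qed.

Lemma attractor_left_limit1 w n s :
  s \in words w n -> left_limit (attractor w) (word_map s 1).
Proof.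
move=> sw e e0; have [m _ me] := ratioX_lt S 0 e0.
have [t tw t1] := word_fix1 (tail n w) m.
exists (word_map (s ++ t) 0).
  exact: (attractor_word (words_cat sw tw) (attractor_0 hull01 _)).
have := word_map1 (words_cat sw tw); rewrite word_map_cat t1 => ->.
have rnm : ratio S ^+ (n + m) < e.
  rewrite (le_lt_trans _ me) // exprD.
  by rewrite ler_piMl ?ratioX_le1 ?(ltW (ratioX_gt0 _ _)).
by have r0 := ratioX_gt0 S (n + m); apply/andP; split; lra.
Qed.

(** A basic interval around the point that is shorter than both excluded
    gaps has an end on one of its sides, and both ends are in the attractor. *)
Lemma attractor_limit w x : attractor w x ->
  right_limit (attractor w) x \/ left_limit (attractor w) x.
Proof.
move=> Kx; apply: contrapT => /not_orP[].
move=> /existsNP[e1 /not_implyP[e10 h1]] /existsNP[e2 /not_implyP[e20 h2]].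
have [n _ ] := @ratioX_lt _ S (Num.min e1 e2) 0 ltac:(by rewrite lt_min e10).
rewrite lt_min => /andP[n1 n2].
have [s sw [y /(attractor01 hull01) /andP[y0 y1] xE]] := attractor_decomp n Kx.
have K0 := attractor_word sw (attractor_0 hull01 _).
have K1 := attractor_word sw (attractor_1 hull01 _).
have := word_map1 sw; have := ratioX_gt0 S n.
have : word_map s 0 <= x <= word_map s 1 by rewrite xE !word_map_le y0 y1.
move=> /andP[x0 x1] rn s1.
have [xs1|s1x] := ltP x (word_map s 1).
  by apply: h1; exists (word_map s 1) => //; apply/andP; split; lra.
by apply: h2; exists (word_map s 0) => //; apply/andP; split; lra.
Qed.

End attractor_words.

(** * Net intervals as consecutive endpoints *)

Section net_intervals.
Context {R : realType} (S : rifs R).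
Implicit Types (w : Omega S) (s t u : seq (indexed_letter S)) (x y z : R).
Implicit Types (D E : R * R).
Context (hull01 : forall w, convex_hull (attractor w) = `[0, 1]%classic).

Lemma zip_beheadP (l : seq R) D : sorted <%R l ->
  (D \in zip l (behead l)) <->
  [/\ D.1 \in l, D.2 \in l, D.1 < D.2 & forall c, c \in l -> ~~ (D.1 < c < D.2)].
Proof.
case: D => a b /=; elim: l => [|x [|y l] IH] //=.
- by move=> _; split => // -[].
- by move=> _; split => // -[]; rewrite !inE => /eqP -> /eqP ->; rewrite ltxx.
move=> /andP[xy yl].
have lt_l c : c \in l -> y < c.
  exact: (allP (order_path_min lt_trans yl)).
rewrite in_cons; split.
- move=> /orP[/eqP[-> ->]|].
    rewrite !inE !eqxx orbT; split => // c.
    rewrite !inE => /or3P[/eqP ->|/eqP ->|/lt_l yc]; rewrite ?ltxx ?andbF //.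
    by rewrite (ltNge c) (ltW yc) andbF.
  move/(proj1 (IH yl)) => [ai bi ab h].
  rewrite inE ai orbT inE bi orbT; split => // c.
  rewrite inE => /predU1P[->|]; last exact: h.
  rewrite (ltNge a) negb_and negbK; apply/orP; left.
  move: ai; rewrite inE => /predU1P[->|/lt_l ya]; apply: ltW => //.
  exact: lt_trans ya.
- move=> [ai bi ab h]; apply/orP.
  move: ai; rewrite inE => /predU1P[aE|ai].
    left; subst a; move: bi; rewrite inE => /predU1P[bE|].
      by rewrite bE ltxx in ab.
    rewrite inE => /predU1P[->//|/lt_l yb].
    by have := h y; rewrite !inE eqxx orbT xy yb => /(_ isT).
  right; apply/(IH yl); split => // [|c cl].
    move: bi; rewrite inE => /predU1P[bE|//]; exfalso.
    have : x < a by move: ai; rewrite inE => /predU1P[->|/lt_l]//; exact: lt_trans.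
    by rewrite ltNge -bE ltW.
  by apply: h; rewrite inE cl orbT.
Qed.

Lemma exists_max (l : seq R) (P : pred R) : has P l ->
  exists a, [/\ a \in l, P a & forall c, c \in l -> P c -> c <= a].
Proof.
elim: l => //= x l IH; have [/IH[a [al Pa amax]] _|nP] := boolP (has P l).
  have [xa|ax] := leP x a.
    by exists a; split => [||c] //; rewrite inE ?al ?orbT // => /predU1P[->|/amax].
  have [Px|nPx] := boolP (P x).
    exists x; split => [||c] //; rewrite inE ?eqxx // => /predU1P[->//|/amax + Pc].
    by move=> /(_ Pc) ca; rewrite ltW // (le_lt_trans ca).
  exists a; split => [||c] //; rewrite inE ?al ?orbT //.
  by move=> /predU1P[->|/amax]; rewrite ?(negbTE nPx).
rewrite orbF => Px; exists x; split => [||c] //; rewrite inE ?eqxx //.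
by move=> /predU1P[->//|cl Pc]; move/hasPn: nP => /(_ c cl); rewrite Pc.
Qed.

Lemma exists_min (l : seq R) (P : pred R) : has P l ->
  exists a, [/\ a \in l, P a & forall c, c \in l -> P c -> a <= c].
Proof.
move=> h; have : has (fun c => P (- c)) (map -%R l).
  by rewrite has_map; apply: sub_has h => x /=; rewrite opprK.
move=> /exists_max[a []]; case/mapP => b bl -> /=; rewrite opprK => Pb hb.
exists b; split => // c cl Pc; rewrite -lerN2.
by apply: hb; [exact: map_f|rewrite opprK].
Qed.

Lemma endpointsP w n h : h \in endpoints w n <->
  exists2 s, s \in words w n & h = word_map s 0 \/ h = word_map s 1.
Proof.
rewrite mem_sort mem_undup; split.
- case/allpairsP => -[s z] /= [sw]; rewrite !inE => /orP[] /eqP -> ->.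
    by exists s => //; left.
  by exists s => //; right.
- move=> [s sw [] ->]; apply/allpairsP.
    by exists (s, 0); rewrite !inE eqxx.
  by exists (s, 1); rewrite !inE eqxx orbT.
Qed.

Lemma endpoints_sorted w n : sorted <%R (endpoints w n).
Proof. by rewrite sort_lt_sorted undup_uniq. Qed.

Definition piece w n D : Prop :=
  [/\ D.1 \in endpoints w n, D.2 \in endpoints w n, D.1 < D.2
    & forall c, c \in endpoints w n -> ~~ (D.1 < c < D.2)].

Definition hits w D : Prop := exists2 x, attractor w x & D.1 < x < D.2.

Lemma endpoints0 w h : h \in endpoints w 0 <-> h = 0 \/ h = 1.
Proof.
rewrite endpointsP; split=> [[s]|[]->].
- by rewrite inE => /eqP -> [] ->; [left|right].
- by exists [::] => //; left.
- by exists [::] => //; right.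
Qed.

(** The filter on consecutive endpoints also describes level 0, where the
    definition of [net_intervals] is a separate case. *)
Lemma netP w n D : D \in net_intervals w n <-> piece w n D /\ hits w D.
Proof.
have hitsE E : hits w E <-> `]E.1, E.2[%classic `&` attractor w !=set0.
  by split=> [[x Kx x12]|[x [+ Kx]]]; exists x; rewrite /= ?in_itv.
case: n => [|n].
- rewrite inE; split => [/eqP ->|[[]]].
    split; first split => /=; rewrite ?ltr01 //.
    + by apply/endpoints0; left.
    + by apply/endpoints0; right.
    + by move=> c /endpoints0[] ->; rewrite ltxx ?andbF.
    have w0 : [::] \in words w 0 by rewrite mem_head.
    have [y Ky] := attractor_right_limit0 hull01 w0 ltr01.
    by rewrite add0r => y01; exists y.
  case: D => a b /= /endpoints0 + /endpoints0.
  by move=> [] -> [] -> //; rewrite ?ltxx // ltNge ler01.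
- rewrite mem_filter; split.
    move=> /andP[/asboolP/hitsE h /zip_beheadP h']; split => //.
    exact/h'/endpoints_sorted.
  move=> [p /hitsE h]; apply/andP; split; first exact/asboolP.
  exact/(zip_beheadP _ (endpoints_sorted _ _)).
Qed.

Lemma citv_sub D E : D.1 <= D.2 ->
  citv D `<=` citv E <-> E.1 <= D.1 /\ D.2 <= E.2.
Proof.
move=> D12; split => [h|[h1 h2] x] /=.
  have := h D.1; have := h D.2; rewrite /citv /= !in_itv /= !lexx D12 /=.
  by move=> /(_ isT) /andP[_ ->] /(_ isT) /andP[->].
by rewrite /citv /= !in_itv /= => /andP[/(le_trans h1) -> /le_trans ->].
Qed.

Lemma childrenP w n D E : E \in children w n D <->
  E \in net_intervals w n.+1 /\ D.1 <= E.1 /\ E.2 <= D.2.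
Proof.
rewrite mem_filter; split => [/andP[/asboolP h En]|[En h]].
  split => //; apply/citv_sub => //.
  by have /netP[[_ _ /ltW]] := En.
apply/andP; split => //; apply/asboolP/citv_sub => //.
by have /netP[[_ _ /ltW]] := En.
Qed.

Lemma endpoints_word w n m s h : s \in words w n ->
  h \in endpoints (tail n w) m -> word_map s h \in endpoints w (n + m).
Proof.
move=> sw /endpointsP[t tw hE]; apply/endpointsP; exists (s ++ t).
  exact: words_cat.
by case: hE => ->; [left|right]; rewrite word_map_cat.
Qed.

Lemma endpoints01 w n : 0 \in endpoints w n /\ 1 \in endpoints w n.
Proof.
split; apply/endpointsP.
  by have [s sw s0] := word_fix0 hull01 w n; exists s; rewrite ?s0; auto.
by have [s sw s1] := word_fix1 hull01 w n; exists s; rewrite ?s1; auto.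
Qed.

Lemma endpoints_sub w n h : h \in endpoints w n -> h \in endpoints w n.+1.
Proof.
have [e0 e1] := endpoints01 (tail n w) 1.
move=> /endpointsP[s sw hE]; rewrite -addn1.
by case: hE => ->; exact: endpoints_word.
Qed.

Lemma endpoints_itv w n h : h \in endpoints w n -> 0 <= h <= 1.
Proof.
by move=> /endpointsP[s sw [] ->]; apply: (word_map_itv hull01 sw);
  rewrite ?lexx ?ler01.
Qed.

Lemma piece_right w n x : 0 <= x < 1 ->
  exists2 D, piece w n D & D.1 <= x < D.2.
Proof.
move=> /andP[x0 x1]; have [e0 e1] := endpoints01 w n.
have [|a [aE ax amax]] := @exists_max (endpoints w n) (fun c => c <= x).
  by apply/hasP; exists 0.
have [|b [bE bx bmin]] := @exists_min (endpoints w n) (fun c => x < c).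
  by apply/hasP; exists 1.
exists (a, b) => /=; last by rewrite ax bx.
split => //=; first exact: le_lt_trans bx.
move=> c cE; apply/negP => /andP[ac cb].
have [cx|xc] := leP c x; first by have := amax _ cE cx; rewrite leNgt ac.
by have := bmin _ cE xc; rewrite leNgt cb.
Qed.

Lemma piece_left w n x : 0 < x <= 1 ->
  exists2 D, piece w n D & D.1 < x <= D.2.
Proof.
move=> /andP[x0 x1]; have [e0 e1] := endpoints01 w n.
have [|a [aE ax amax]] := @exists_max (endpoints w n) (fun c => c < x).
  by apply/hasP; exists 0.
have [|b [bE bx bmin]] := @exists_min (endpoints w n) (fun c => x <= c).
  by apply/hasP; exists 1.
exists (a, b) => /=; last by rewrite ax bx.
split => //=; first exact: lt_le_trans bx.
move=> c cE; apply/negP => /andP[ac cb].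
have [xc|cx] := leP x c; first by have := bmin _ cE xc; rewrite leNgt cb.
by have := amax _ cE cx; rewrite leNgt ac.
Qed.

(** Taking at each level the net interval on a side from which the point is
    approximated gives nested intervals; an arbitrary choice among two
    adjacent intervals could leave no child containing the point. *)
Lemma chain_exists w x : attractor w x ->
  exists D : nat -> R * R,
    [/\ forall n, D n \in net_intervals w n,
        forall n, (D n).1 <= x <= (D n).2
      & forall n, D n.+1 \in children w n (D n)].
Proof.
move=> Kx; have [xr|xl] := attractor_limit hull01 Kx.
- have x01 : 0 <= x < 1.
    have /andP[-> _] := attractor01 hull01 Kx.
    have [y /(attractor01 hull01) /andP[_ y1] /andP[xy _]] := xr _ ltr01.
    exact: lt_le_trans y1.
  have /choice[D hD] : forall n, exists D, piece w n D /\ D.1 <= x < D.2.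
    by move=> n; have [D] := piece_right w n x01; exists D.
  have netD n : D n \in net_intervals w n.
    have [pD /andP[Dx xD]] := hD n; apply/netP; split => //.
    have [|y Ky /andP[xy yD]] := xr ((D n).2 - x); first by rewrite subr_gt0.
    by exists y; rewrite // (le_lt_trans Dx xy) /=; move: yD; rewrite addrC subrK.
  exists D; split => // n.
    by have [_ /andP[-> /ltW ->]] := hD n.
  apply/childrenP; split => //.
  have [[E1 E2 _ _] /andP[D1 D2]] := hD n.
  have [[_ _ _ h] /andP[D1' D2']] := hD n.+1.
  have := h _ (endpoints_sub E1); have := h _ (endpoints_sub E2).
  rewrite !negb_and -!leNgt (leNgt (D n).2) (le_lt_trans D1' D2) /= => h2.
  by rewrite [X in _ || X]leNgt (le_lt_trans D1 D2') orbF => h1.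
- have x01 : 0 < x <= 1.
    have /andP[_ ->] := attractor01 hull01 Kx.
    have [y /(attractor01 hull01) /andP[y0 _] /andP[_ yx]] := xl _ ltr01.
    by rewrite andbT; exact: le_lt_trans yx.
  have /choice[D hD] : forall n, exists D, piece w n D /\ D.1 < x <= D.2.
    by move=> n; have [D] := piece_left w n x01; exists D.
  have netD n : D n \in net_intervals w n.
    have [pD /andP[Dx xD]] := hD n; apply/netP; split => //.
    have [|y Ky /andP[xy yD]] := xl (x - (D n).1); first by rewrite subr_gt0.
    exists y; rewrite // (lt_le_trans yD xD) andbT.
    by move: xy; rewrite opprB addrC subrK.
  exists D; split => // n.
    by have [_ /andP[/ltW -> ->]] := hD n.
  apply/childrenP; split => //.
  have [[E1 E2 _ _] /andP[D1 D2]] := hD n.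
  have [[_ _ _ h] /andP[D1' D2']] := hD n.+1.
  have := h _ (endpoints_sub E1); have := h _ (endpoints_sub E2).
  rewrite !negb_and -!leNgt (leNgt (D n).2) (lt_le_trans D1' D2) /= => h2.
  by rewrite [X in _ || X]leNgt (lt_le_trans D1 D2') orbF => h1.
Qed.

(** Together with [chain_exists] this identifies the members of a chain: it
    goes through every net interval that has the point in its interior. *)
Lemma piece_unique w n D E x : piece w n D -> piece w n E ->
  D.1 <= x <= D.2 -> E.1 < x < E.2 -> D = E.
Proof.
case: D E => [a b] [c d] [/= ae be ab hab] [/= ce de cd hcd].
move=> /andP[ax xb] /andP[cx xd].
have ac : a <= c.
  by have := hcd _ ae; rewrite (le_lt_trans ax xd) andbT -leNgt.
have db : d <= b.
  by have := hcd _ be; rewrite (lt_le_trans cx xb) /= -leNgt.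
have := hab _ ce; rewrite (lt_le_trans cd db) andbT -leNgt => ca.
have := hab _ de; rewrite (le_lt_trans ac cd) /= -leNgt => bd.
by congr (_, _); apply/eqP; rewrite eq_le ?ac ?db ?ca ?bd.
Qed.

End net_intervals.

(** * The characteristic vector of a child is determined by the past *)

Section transfer.
Context {R : realType} (S : rifs R).
Implicit Types (w : Omega S) (s t u : seq (indexed_letter S)) (x y z : R).
Implicit Types (D E : R * R).
Context (hull01 : forall w, convex_hull (attractor w) = `[0, 1]%classic).

Definition covers s D : bool := (word_map s 0 <= D.1) && (D.2 <= word_map s 1).

Lemma citv_sub_word D s : D.1 <= D.2 ->
  citv D `<=` word_map s @` `[0, 1]%classic <-> covers s D.
Proof.
move=> D12.
have -> : word_map s @` `[0, 1]%classic = citv (word_map s 0, word_map s 1).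
  apply/seteqP; split => x; rewrite /citv /= in_itv /=.
    by move=> [y]; rewrite in_itv /= => /andP[y0 y1] <-; rewrite !word_map_le y0.
  move=> /andP[x0 x1]; have rs := ratioX_gt0 S (size s).
  exists ((x - word_map s 0) / ratio S ^+ size s); last first.
    by rewrite word_mapE mulrC divfK ?lt0r_neq0 // subrK.
  rewrite in_itv /= divr_ge0 ?subr_ge0 ?(ltW rs) //= ler_pdivrMr // mul1r.
  by rewrite lerBlDr -[X in X + _]mulr1 -word_mapE.
by rewrite citv_sub // /covers; split => [[-> ->]|/andP[]].
Qed.

Definition offset n D s : R := ratio S ^- n * (D.1 - word_map s 0).

Lemma neighbourP w n D v : D.1 <= D.2 ->
  v \in neighbour_set w n D <->
  exists s, [/\ s \in words w n, covers s D & v = offset n D s].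
Proof.
move=> D12; rewrite mem_sort mem_undup; split.
  move=> /mapP[s]; rewrite mem_filter => /andP[/asboolP/citv_sub_word + sw vE].
  by move=> /(_ D12) sD; exists s.
move=> [s [sw sD vE]]; apply/mapP; exists s => //; rewrite mem_filter sw andbT.
exact/asboolP/citv_sub_word.
Qed.

Lemma neighbour_sorted w n D : sorted <%R (neighbour_set w n D).
Proof. by rewrite sort_lt_sorted undup_uniq. Qed.

Lemma piece_lt w n D : piece w n D -> D.1 < D.2. Proof. by case. Qed.

(** The ends of a basic interval of level [n] are endpoints of level [n], so
    they cannot cut the interior of [D]. *)
Lemma piece_covers w n D s x : piece w n D -> s \in words w n ->
  word_map s 0 <= x <= word_map s 1 -> D.1 < x < D.2 -> covers s D.
Proof.
case=> _ _ _ h sw /andP[s0 s1] /andP[Dx xD].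
have := h (word_map s 0) ltac:(apply/endpointsP; exists s; auto).
have := h (word_map s 1) ltac:(apply/endpointsP; exists s; auto).
rewrite (lt_le_trans Dx s1) /= -leNgt => h1.
by rewrite (le_lt_trans s0 xD) andbT -leNgt => h0; rewrite /covers h0.
Qed.

Lemma word_map_offset w n D s y : s \in words w n ->
  word_map s y = D.1 + ratio S ^+ n * (y - offset n D s).
Proof.
move=> sw; rewrite /offset mulrBr mulrA mulfV ?ratioX_neq0 // mul1r.
by rewrite word_mapE (size_words sw); ring.
Qed.

(** In normalized coordinates the condition mentions the length, the
    neighbour set and the letters still to come, and nothing else. *)
Lemma hitsE w n D : piece w n D ->
  hits w D <-> exists2 v, v \in neighbour_set w n D &
    exists2 y, attractor (tail n w) y & 0 < y - v < normalized_length S n D.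
Proof.
move=> pD; have D12 := ltW (piece_lt pD); have rn := ratioX_gt0 S n.
have inE' y v : (0 < y - v < normalized_length S n D) =
    (D.1 < D.1 + ratio S ^+ n * (y - v) < D.2).
  by rewrite ltrDl pmulr_rgt0 // /normalized_length ltr_pdivlMl // -ltrBrDl.
split.
- move=> [x Kx xD]; have [s sw [y Ky xE]] := attractor_decomp hull01 n Kx.
  have sD : covers s D.
    apply: (piece_covers pD sw _ xD); rewrite xE !word_map_le.
    exact: attractor01 Ky.
  exists (offset n D s); first by apply/neighbourP => //; exists s.
  by exists y; rewrite // inE' -(word_map_offset D y sw) -xE.
- move=> [v /(neighbourP _ _ _ D12)[s [sw sD ->]]] [y Ky]; rewrite inE'.
  rewrite -(word_map_offset D y sw) => h.
  by exists (word_map s y) => //; exact: (attractor_word hull01 sw Ky).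
Qed.

Definition same_type w n D w' n' D' : Prop :=
  normalized_length S n D = normalized_length S n' D' /\
  neighbour_set w n D = neighbour_set w' n' D'.

Lemma hits_transfer w n D w' n' D' : piece w n D -> piece w' n' D' ->
  same_type w n D w' n' D' -> tail n w = tail n' w' -> hits w D -> hits w' D'.
Proof.
by move=> pD pD' [l V] ht /(hitsE pD) h; apply/(hitsE pD'); rewrite -l -V -ht.
Qed.

(** The increasing affine map that takes the left end of [D] to that of
    [D'] and level [n] to level [n']. *)
Definition rescale n D n' D' x : R :=
  D'.1 + ratio S ^+ n' * ratio S ^- n * (x - D.1).

Definition rescale_itv n D n' D' E : R * R :=
  (rescale n D n' D' E.1, rescale n D n' D' E.2).

Lemma rescaleK n D n' D' x : rescale n' D' n D (rescale n D n' D' x) = x.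
Proof.
by rewrite /rescale; field; rewrite !ratioX_neq0.
Qed.

Lemma rescale_itvK n D n' D' E :
  rescale_itv n' D' n D (rescale_itv n D n' D' E) = E.
Proof. by case: E => a b; rewrite /rescale_itv /= !rescaleK. Qed.

Lemma rescale_id n D x : rescale n D n D x = x.
Proof. by rewrite /rescale; field; rewrite !ratioX_neq0. Qed.

Lemma rescale_itv_id n D E : rescale_itv n D n D E = E.
Proof. by case: E => a b; rewrite /rescale_itv /= !rescale_id. Qed.

Lemma rescale_scale_gt0 n n' : 0 < ratio S ^+ n' * ratio S ^- n.
Proof. by rewrite mulr_gt0 ?invr_gt0 ?ratioX_gt0. Qed.

Lemma rescale_lt n D n' D' x y :
  (rescale n D n' D' x < rescale n D n' D' y) = (x < y).
Proof. by rewrite /rescale ltrD2l ltr_pM2l ?rescale_scale_gt0 // ltrD2r. Qed.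

Lemma rescale_le n D n' D' x y :
  (rescale n D n' D' x <= rescale n D n' D' y) = (x <= y).
Proof. by rewrite /rescale lerD2l ler_pM2l ?rescale_scale_gt0 // lerD2r. Qed.

Lemma rescale1 n D n' D' : rescale n D n' D' D.1 = D'.1.
Proof. by rewrite /rescale subrr mulr0 addr0. Qed.

Lemma rescale2 n D n' D' : normalized_length S n D = normalized_length S n' D' ->
  rescale n D n' D' D.2 = D'.2.
Proof.
rewrite /rescale /normalized_length -mulrA => ->.
by rewrite mulrA mulfV ?ratioX_neq0 // mul1r addrC subrK.
Qed.

Lemma normalized_length_rescale n D n' D' E :
  normalized_length S n'.+1 (rescale_itv n D n' D' E) = normalized_length S n.+1 E.
Proof.
rewrite /normalized_length /rescale_itv /rescale /= !exprS; field.
by rewrite !ratioX_neq0 ?lt0r_neq0 ?ratio_gt0.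
Qed.

(** What the subdivision of a net interval depends on, apart from the letters
    after the next one. *)
Definition twins w n D w' n' D' : Prop :=
  [/\ piece w n D, piece w' n' D', same_type w n D w' n' D' & w n = w' n'].

Lemma twins_sym w n D w' n' D' : twins w n D w' n' D' -> twins w' n' D' w n D.
Proof. by case=> p p' [l V] e; split => //; split. Qed.

(** A word that reaches the interior of [D] extends a word of level [n] that
    covers [D]; a word with the same offset covers [D'], and both can be
    continued by the same letter. *)
Lemma twin_word w n D w' n' D' u x : twins w n D w' n' D' ->
  u \in words w n.+1 -> word_map u 0 <= x <= word_map u 1 -> D.1 < x < D.2 ->
  exists2 u', u' \in words w' n'.+1 &
    forall y, word_map u' y = rescale n D n' D' (word_map u y).
Proof.
move=> [p p' [_ V] e]; rewrite -addn1 => /words_split[sw dw] + xD.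
rewrite -{1 2}(cat_take_drop n u) !word_map_cat => /andP[u0 u1].
set s := take n u in sw u0 u1 *; set d := drop n u in dw u0 u1 *.
have d0 : 0 <= word_map d 0 <= 1.
  by apply: (word_map_itv hull01 dw); rewrite lexx ler01.
have d1 : 0 <= word_map d 1 <= 1.
  by apply: (word_map_itv hull01 dw); rewrite lexx ler01.
have sD : covers s D.
  apply: (piece_covers p sw _ xD); apply/andP; split.
    by apply: le_trans u0; rewrite word_map_le; case/andP: d0.
  by apply: le_trans u1 _; rewrite word_map_le; case/andP: d1.
have : offset n D s \in neighbour_set w n D.
  by apply/neighbourP; [exact/ltW/(piece_lt p)|exists s].
rewrite V => /neighbourP[|s' [sw' _ vE]]; first exact/ltW/(piece_lt p').
have dw' : d \in words (tail n' w') 1.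
  by move: dw; rewrite !mem_words /mkseq /= !tailE !addn0 e.
exists (s' ++ d) => [|y]; first by rewrite -addn1; exact: words_cat.
rewrite -(cat_take_drop n u) !word_map_cat -/s -/d.
rewrite (word_map_offset D' _ sw') (word_map_offset D _ sw) -vE /rescale.
by field; rewrite ratioX_neq0.
Qed.

Lemma endpoints_rescale w n D w' n' D' c : twins w n D w' n' D' ->
  c \in endpoints w n.+1 -> D.1 <= c <= D.2 ->
  rescale n D n' D' c \in endpoints w' n'.+1.
Proof.
move=> tw cE /andP[Dc cD]; have [p [p1 p2 _ _] [l _] _] := tw.
have [->|Dc'] := eqVneq c D.1.
  by rewrite rescale1; exact: (endpoints_sub hull01).
have [->|cD'] := eqVneq c D.2.
  by rewrite rescale2 //; exact: (endpoints_sub hull01).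
have cD2 : D.1 < c < D.2 by rewrite !lt_neqAle Dc cD eq_sym Dc' cD'.
move: cE => /endpointsP[u uw cu].
have [|u' uw' h] := twin_word tw uw _ cD2; last first.
  apply/endpointsP; exists u' => //.
  by case: cu => ->; [left|right]; rewrite h.
by case: cu => ->; rewrite ?lexx ?word_map_le ?ler01.
Qed.

Lemma piece_rescale w n D w' n' D' E : twins w n D w' n' D' ->
  piece w n.+1 E -> D.1 <= E.1 -> E.2 <= D.2 ->
  piece w' n'.+1 (rescale_itv n D n' D' E).
Proof.
move=> tw [E1 E2 E12 h] DE ED; have [p p' [l _] _] := tw.
split => /=.
- by apply: (endpoints_rescale tw) => //; rewrite DE (le_trans (ltW E12)).
- by apply: (endpoints_rescale tw) => //; rewrite ED (le_trans _ (ltW E12)).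
- by rewrite rescale_lt.
- move=> c cE; apply/negP => /andP[c1 c2].
  have cD : D'.1 <= c <= D'.2.
    rewrite -(rescale1 n D n' D') -(rescale2 l).
    rewrite (le_trans _ (ltW c1)) ?rescale_le //=.
    by rewrite (le_trans (ltW c2)) ?rescale_le.
  have := h _ (endpoints_rescale (twins_sym tw) cE cD).
  move: c1 c2; rewrite -{1 2}(rescaleK n' D' n D c) !rescale_lt => -> ->.
  by [].
Qed.

Lemma neighbour_rescale_sub w n D w' n' D' E : twins w n D w' n' D' ->
  piece w n.+1 E -> D.1 <= E.1 -> E.2 <= D.2 ->
  {subset neighbour_set w n.+1 E
     <= neighbour_set w' n'.+1 (rescale_itv n D n' D' E)}.
Proof.
move=> tw pE DE ED v; have E12 := piece_lt pE.
move=> /(neighbourP _ _ _ (ltW E12))[u [uw /andP[u0 u1] ->]].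
pose x := (E.1 + E.2) / 2.
have [|| u' uw' h] := @twin_word _ _ _ _ _ _ u x tw uw.
- by apply/andP; split; rewrite /x; lra.
- by apply/andP; split; rewrite /x; lra.
apply/neighbourP; first by rewrite /= rescale_le ltW.
exists u'; split => //; first by rewrite /covers /= !h !rescale_le u0.
rewrite /offset h /= /rescale !exprS; field.
by rewrite !ratioX_neq0 lt0r_neq0 ?ratio_gt0.
Qed.

Lemma same_type_rescale w n D w' n' D' E : twins w n D w' n' D' ->
  piece w n.+1 E -> D.1 <= E.1 -> E.2 <= D.2 ->
  same_type w n.+1 E w' n'.+1 (rescale_itv n D n' D' E).
Proof.
move=> tw pE DE ED; split; first by rewrite normalized_length_rescale.
apply: lt_sorted_eq; rewrite ?neighbour_sorted // => v; apply/idP/idP.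
  exact: neighbour_rescale_sub.
have [_ _ [l _] _] := tw.
have := @neighbour_rescale_sub _ _ _ _ _ _ (rescale_itv n D n' D' E)
  (twins_sym tw) (piece_rescale tw pE DE ED).
rewrite rescale_itvK; apply => /=.
- by rewrite -(rescale1 n D n' D') rescale_le.
- by rewrite -(rescale2 l) rescale_le.
Qed.

(** Two net intervals of one level that contain [E] share interior points. *)
Lemma parentE w n D E : D \in net_intervals w n -> E \in children w n D ->
  parent w n E = D.
Proof.
move=> Dn /(childrenP hull01)[/(netP hull01)[pE _] [DE ED]]; have E12 := piece_lt pE.
rewrite /parent; set l := [seq _ <- _ | _].
have Dl : D \in l.
  by rewrite mem_filter Dn andbT; apply/asboolP/citv_sub => //; exact: ltW.
have : head (0, 1) l \in l by case: (l) Dl => //= a l'; rewrite mem_head.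
rewrite mem_filter => /andP[/asboolP/citv_sub + /(netP hull01)[pH _]].
move=> /(_ (ltW E12)) [HE EH].
move/(netP hull01): Dn => [pD _].
apply: (@piece_unique _ _ w n _ _ ((E.1 + E.2) / 2)) => //; apply/andP; split; lra.
Qed.

Definition left_of : rel (R * R) := fun D E => D.1 < E.1.

Lemma zip_behead_sorted (l : seq R) : sorted <%R l -> sorted left_of (zip l (behead l)).
Proof.
elim: l => [|x [|y l] IH] //= /andP[xy yl].
by case: l yl IH => [|z l] //= /andP[yz zl] IH; rewrite /left_of /= xy IH // yz.
Qed.

Lemma left_of_trans : transitive left_of.
Proof. by move=> D E F; exact: lt_trans. Qed.

Lemma net_sorted w n : sorted left_of (net_intervals w n).
Proof.
case: n => [//|n]; apply: sorted_filter; first exact: left_of_trans.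
exact/zip_behead_sorted/endpoints_sorted.
Qed.

Definition siblings w n D E : seq (R * R) :=
  [seq E' <- children w n D |
    (normalized_length S n.+1 E' == normalized_length S n.+1 E) &&
    (neighbour_set w n.+1 E' == neighbour_set w n.+1 E)].

Lemma siblingsP w n D E F : F \in siblings w n D E <->
  F \in children w n D /\ same_type w n.+1 F w n.+1 E.
Proof.
rewrite mem_filter; split => [/andP[/andP[/eqP ? /eqP ?]]|] //.
by move=> [-> [-> ->]]; rewrite !eqxx.
Qed.

(** Siblings of the same length and neighbour set have the same offsets and
    the same future, hence they meet the attractor simultaneously. *)
Lemma rescale_siblings w n D w' n' D' E F : twins w n D w' n' D' ->
  E \in children w n D -> hits w' (rescale_itv n D n' D' E) ->
  F \in siblings w n D E ->
  rescale_itv n D n' D' F \in siblings w' n' D' (rescale_itv n D n' D' E).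
Proof.
move=> tw /(childrenP hull01)[/(netP hull01)[pE _] [DE ED]] mE.
move=> /siblingsP[/(childrenP hull01)[/(netP hull01)[pF _] [DF FD]] [lFE VFE]].
have [lE VE] := same_type_rescale tw pE DE ED.
have [lF VF] := same_type_rescale tw pF DF FD.
have pE' := piece_rescale tw pE DE ED; have pF' := piece_rescale tw pF DF FD.
have st : same_type w' n'.+1 (rescale_itv n D n' D' F)
    w' n'.+1 (rescale_itv n D n' D' E).
  by split; [rewrite -lE -lF|rewrite -VE -VF].
have [_ _ [l _] _] := tw.
apply/siblingsP; split => //; apply/(childrenP hull01); split.
  apply/(netP hull01); split => //; apply: (hits_transfer pE' pF' _ _ mE) => //.
  by case: st => ? ?; split.
by rewrite -(rescale1 n D n' D') -(rescale2 l) /= !rescale_le.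
Qed.

(** No hypothesis relates the tails of [w] and [w']: by [rescale_siblings] the
    lists of siblings that define the rank correspond as soon as one of them
    is present on both sides. *)
Lemma transfer w n D w' n' D' E : twins w n D w' n' D' ->
  D \in net_intervals w n -> D' \in net_intervals w' n' ->
  E \in children w n D -> hits w' (rescale_itv n D n' D' E) ->
  rescale_itv n D n' D' E \in children w' n' D' /\
  charvec_of w' n'.+1 (rescale_itv n D n' D' E) = charvec_of w n.+1 E.
Proof.
move=> tw Dn Dn' Ec mE.
have [/(netP hull01)[pE mE0] [DE ED]] := (childrenP hull01 _ _ _ _).1 Ec.
have [lE VE] := same_type_rescale tw pE DE ED.
have Es : E \in siblings w n D E by apply/siblingsP.
have /siblingsP[Ec' _] := rescale_siblings tw Ec mE Es.
split => //; rewrite /charvec_of -lE -VE; congr (_, _, _).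
rewrite /= !(parentE _ Ec) // !(parentE _ Ec') //.
rewrite -/(siblings w n D E) -/(siblings w' n' D' (rescale_itv n D n' D' E)).
congr _.+1; rewrite -[RHS](index_map (can_inj (rescale_itvK n D n' D'))); congr index.
apply: (irr_sorted_eq left_of_trans) => [F| | |F].
- exact: ltxx.
- by do 2 (apply: sorted_filter; first exact: left_of_trans); exact: net_sorted.
- rewrite sorted_map; apply: sub_sorted (_ : sorted left_of _).
    by move=> F G; rewrite /= /left_of /= rescale_lt.
  by do 2 (apply: sorted_filter; first exact: left_of_trans); exact: net_sorted.
- apply/idP/mapP => [Fs|[G Gs ->]]; last exact: (rescale_siblings tw).
  exists (rescale_itv n' D' n D F); last by rewrite rescale_itvK.
  have := rescale_siblings (twins_sym tw) Ec' _ Fs.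
  by rewrite rescale_itvK; apply.
Qed.

Lemma net_parent w n D : D \in net_intervals w n.+1 ->
  exists2 E, E \in net_intervals w n & D \in children w n E.
Proof.
move=> /(netP hull01)[pD [x Kx xD]].
have [C [netC Cx chC]] := chain_exists hull01 Kx.
exists (C n) => //.
suff -> : D = C n.+1 by [].
have /(netP hull01)[pC _] := netC n.+1.
by rewrite (piece_unique pC pD (Cx _) xD).
Qed.

Lemma endpoints_prefix w w' n : mkseq w n = mkseq w' n ->
  endpoints w n =i endpoints w' n.
Proof.
move=> h c; apply/idP/idP => /endpointsP[s sw cE]; apply/endpointsP;
  by exists s; rewrite // mem_words -?h -mem_words // mem_words h -mem_words.
Qed.

Lemma piece_prefix w w' n D : mkseq w n = mkseq w' n -> piece w n D -> piece w' n D.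
Proof.
move=> /endpoints_prefix h [D1 D2 D12 hD]; split; rewrite -?h // => c.
by rewrite -h; exact: hD.
Qed.

Lemma same_type_prefix w w' n D : mkseq w n = mkseq w' n -> same_type w n D w' n D.
Proof.
move=> h; split => //; apply: lt_sorted_eq; rewrite ?neighbour_sorted // => v.
rewrite !mem_sort !mem_undup; apply: eq_mem_map => s.
by rewrite !mem_filter (words_prefix h).
Qed.

(** The level-[n] data only see the first [n] letters once the interval is
    known to meet the attractor; the rank is handled by [transfer] applied to
    the parent. *)
Lemma prefix_change w w' n D : mkseq w n = mkseq w' n ->
  D \in net_intervals w n -> hits w' D ->
  D \in net_intervals w' n /\ charvec_of w' n D = charvec_of w n D.
Proof.
case: n => [|n] h Dn mD.
  split; first by move: Dn; rewrite !inE.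
  by rewrite /charvec_of (same_type_prefix D h).2.
have h' : mkseq w n = mkseq w' n.
  by apply/eq_mkseqP => i lti; move/eq_mkseqP: h; apply; exact: ltnW.
have e : w n = w' n by move/eq_mkseqP: h; apply.
have [Q Qn DQ] := net_parent Dn; have /(netP hull01)[pQ _] := Qn.
have [_ [QD DQ']] := (childrenP hull01 _ _ _ _).1 DQ.
have Qn' : Q \in net_intervals w' n.
  apply/(netP hull01); split; first exact: piece_prefix pQ.
  have [x Kx /andP[Dx xD]] := mD.
  by exists x; rewrite // (le_lt_trans QD) // (lt_le_trans xD).
have tw : twins w n Q w' n Q.
  by split => //; [exact: piece_prefix pQ|exact: same_type_prefix].
have := transfer tw Qn Qn' DQ; rewrite rescale_itv_id.
by move=> /(_ mD)[/(childrenP hull01)[]].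
Qed.

End transfer.

(** * Concatenation of admissible paths and the essential class *)

Section paths.
Context {R : realType} (S : rifs R).
Implicit Types (w : Omega S) (s t u : seq (indexed_letter S)) (x y z : R).
Implicit Types (D E : R * R) (C : nat -> R * R) (g b : @charvec R).
Context (hull01 : forall w, convex_hull (attractor w) = `[0, 1]%classic).

Definition chain w N k C : Prop :=
  (forall i, (i <= k)%N -> C i \in net_intervals w (N + i)) /\
  (forall i, (i < k)%N -> C i.+1 \in children w (N + i) (C i)).

(** [b] can be reached from [g] by an admissible path of positive length. *)
Definition linked g b : Prop := exists w N k C,
  [/\ (0 < k)%N, chain w N k C, g = charvec_of w (N + 0) (C 0%N)
    & b = charvec_of w (N + k) (C k)].

Lemma chain_nested w N k C i : chain w N k C -> (i <= k)%N ->
  (C i).1 <= (C k).1 /\ (C k).2 <= (C i).2.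
Proof.
move=> [_ h]; elim: k h => [|k IH] h; first by rewrite leqn0 => /eqP ->.
rewrite leq_eqVlt => /predU1P[-> //|ik].
have [ck1 ck2] := IH (fun j jk => h j (ltnW jk)) ik.
have [_ [h1 h2]] := (childrenP hull01 _ _ _ _).1 (h k (leqnn _)).
by split; [exact: le_trans ck1 h1|exact: le_trans h2 ck2].
Qed.

Lemma tail_eq w w' n n' i : tail n w = tail n' w' -> tail (n + i) w = tail (n' + i) w'.
Proof. by move=> h; rewrite -!tailD h. Qed.

Lemma tail_letter w w' n n' : tail n w = tail n' w' -> w n = w' n'.
Proof. by move=> /(congr1 (fun f => f 0%N)); rewrite !tailE !addn0. Qed.

Lemma transfer_tail w n D w' n' D' E :
  D \in net_intervals w n -> D' \in net_intervals w' n' ->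
  same_type w n D w' n' D' -> tail n w = tail n' w' -> E \in children w n D ->
  rescale_itv S n D n' D' E \in children w' n' D' /\
  charvec_of w' n'.+1 (rescale_itv S n D n' D' E) = charvec_of w n.+1 E.
Proof.
move=> Dn Dn' st ht Ec.
have [pD _] := (netP hull01 _ _ _).1 Dn; have [pD' _] := (netP hull01 _ _ _).1 Dn'.
have tw : twins w n D w' n' D' by split => //; exact: tail_letter.
apply: (transfer hull01) => //.
have [/(netP hull01)[pE hE] [DE ED]] := (childrenP hull01 _ _ _ _).1 Ec.
apply: (hits_transfer hull01 pE _ _ _ hE).
- exact: (piece_rescale hull01 tw).
- exact: (same_type_rescale hull01 tw).
- by rewrite -(addn1 n) -(addn1 n'); exact: tail_eq.
Qed.

Lemma charvec_same_type w n D w' n' D' :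
  charvec_of w n D = charvec_of w' n' D' -> same_type w n D w' n' D'.
Proof. by case. Qed.

(** The rescaled chain is built step by step, since each step is governed by
    the affine map between the current intervals. *)
Lemma transfer_chain w N k C w' N' D' : chain w N k C ->
  D' \in net_intervals w' N' -> tail N w = tail N' w' ->
  charvec_of w N (C 0%N) = charvec_of w' N' D' ->
  exists2 C', chain w' N' k C' /\ C' 0%N = D' &
    forall i, (i <= k)%N -> charvec_of w' (N' + i) (C' i) = charvec_of w (N + i) (C i).
Proof.
move=> [netC chC] Dn' ht e.
pose C' := fix C' i := if i is j.+1
  then rescale_itv S (N + j) (C j) (N' + j) (C' j) (C j.+1) else D'.
have inv i : (i <= k)%N -> C' i \in net_intervals w' (N' + i) /\
    charvec_of w' (N' + i) (C' i) = charvec_of w (N + i) (C i).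
  elim: i => [_|i IH ik]; first by rewrite !addn0.
  have [cn ce] := IH (ltnW ik).
  have [] := transfer_tail (netC i (ltnW ik)) cn
    (charvec_same_type (esym ce)) (tail_eq i ht) (chC i ik).
  by rewrite !addnS => /(childrenP hull01)[].
exists C' => [|i /inv[]] //; split => //; split => i ik; first by have [] := inv i ik.
have [cn ce] := inv i (ltnW ik).
by have [] := transfer_tail (netC i (ltnW ik)) cn
    (charvec_same_type (esym ce)) (tail_eq i ht) (chC i ik).
Qed.

Definition splice w n w' : Omega S := fun i => if (i < n)%N then w i else w' (i - n)%N.

Lemma splice_prefix w n w' m : (m <= n)%N -> mkseq (splice w n w') m = mkseq w m.
Proof.
by move=> mn; apply/eq_mkseqP => i im; rewrite /splice (leq_trans im mn).
Qed.

Lemma splice_tail w n w' : tail n (splice w n w') = w'.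
Proof.
by apply/funext => i; rewrite tailE /splice ltnNge leq_addr /= addKn.
Qed.

(** Replace the letters after the first path by those of the second one.  The
    interval where the paths meet still meets the attractor, because it has the
    type and now also the tail of the start of the second path; therefore so do
    all the intervals that contain it. *)
Lemma linked_trans g c b : linked g c -> linked c b -> linked g b.
Proof.
move=> [w1 [N1 [k1 [C1 [k10 ch1 -> ->]]]]] [w2 [N2 [k2 [C2 [k20 ch2 e ->]]]]].
rewrite !addn0 in e *; have [net1 chi1] := ch1; have [net2 chi2] := ch2.
pose M := (N1 + k1)%N; pose w := splice w1 M (tail N2 w2).
have prefix i : (i <= k1)%N -> mkseq w1 (N1 + i) = mkseq w (N1 + i).
  by move=> ik; rewrite splice_prefix // leq_add2l.
have ht : tail M w = tail N2 w2 by exact: splice_tail.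
have n2 : C2 0%N \in net_intervals w2 N2 by have := net2 0%N isT; rewrite addn0.
have hk : hits w (C1 k1).
  have /(netP hull01)[p1 _] := net1 k1 (leqnn _).
  have /(netP hull01)[p2 h2] := n2.
  apply: (hits_transfer hull01 p2 _ _ (esym ht) h2).
    exact: piece_prefix (prefix _ (leqnn _)) p1.
  have [l1 v1] := charvec_same_type e.
  have [l2 v2] := same_type_prefix (C1 k1) (prefix _ (leqnn _)).
  by split; [rewrite -l1|rewrite -v1 -v2].
have pc i : (i <= k1)%N -> C1 i \in net_intervals w (N1 + i) /\
    charvec_of w (N1 + i) (C1 i) = charvec_of w1 (N1 + i) (C1 i).
  move=> ik; apply: (prefix_change hull01); [exact: prefix|exact: net1|].
  have [a1 a2] := chain_nested ch1 ik.
  have [x Kx /andP[x1 x2]] := hk.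
  by exists x; rewrite // (le_lt_trans a1) // (lt_le_trans x2).
have [|C' [[net' chi'] C'0] hC'] := transfer_chain ch2 (pc k1 (leqnn _)).1 (esym ht).
  by rewrite (pc k1 (leqnn _)).2 e.
(* The two chains overlap at i = k1, where C' 0 is C1 k1. *)
pose C i := if (i <= k1)%N then C1 i else C' (i - k1)%N.
exists w, N1, (k1 + k2)%N, C; split.
- by rewrite addn_gt0 k10.
- split => i ik; rewrite /C.
    case: leqP => [ik1|k1i]; first by have [] := pc i ik1.
    have := net' (i - k1)%N; rewrite /M -addnA (subnKC (ltnW k1i)); apply.
    by rewrite leq_subLR.
  case: (ltngtP i k1) => [ik1|k1i|ik1].
  + apply/(childrenP hull01); split.
      by rewrite -addnS; have [] := pc i.+1 ik1.
    by have [] := (childrenP hull01 _ _ _ _).1 (chi1 i ik1).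
  + have := chi' (i - k1)%N; rewrite /M -addnA (subnKC (ltnW k1i)) (subSn (ltnW k1i)).
    by apply; rewrite ltn_subLR // ltnW.
  + subst i; rewrite -addn1 addKn; have := chi' 0%N k20.
    by rewrite C'0 addn0.
- by rewrite /C leq0n (pc 0%N (leq0n _)).2 addn0.
- have k12 : (k1 + k2 <= k1)%N = false by lia.
  rewrite /C k12 addKn addnA.
  by rewrite hC'.
Qed.

Lemma chain_linked w N k C i j : chain w N k C -> (i < j <= k)%N ->
  linked (charvec_of w (N + i) (C i)) (charvec_of w (N + j) (C j)).
Proof.
move=> [netC chC] /andP[ij jk].
exists w, (N + i)%N, (j - i)%N, (fun l => C (i + l)%N).
rewrite subn_gt0 ij !addn0 -addnA (subnKC (ltnW ij)); split => //.
split => l; rewrite -?addnA => lj.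
  by apply: netC; rewrite (leq_trans _ jk) // -(subnKC (ltnW ij)) leq_add2l.
rewrite addnS; apply: chC; rewrite (leq_trans _ jk) //.
by lia.
Qed.

Lemma chain_admissible w N k C : chain w N k C ->
  admissible_path (mkseq (tail N w) k)
    (mkseq (fun i => charvec_of w (N + i) (C i)) k.+1).
Proof.
move=> [netC chC]; exists w, N, C; rewrite size_mkseq; split => //.
by apply: eq_mkseq => i; rewrite tailE.
Qed.

Lemma admissible_chain nu (l : seq (@charvec R)) : @admissible_path R S nu l ->
  exists w N C, chain w N (size nu) C /\
    l = mkseq (fun i => charvec_of w (N + i) (C i)) (size nu).+1.
Proof. by move=> [w [N [C [_ <- h1 h2]]]]; exists w, N, C. Qed.

Lemma child_linked g b : child S g b -> linked g b.
Proof.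
move=> [j /admissible_chain[w [N [C [ch]]]]] /= [-> ->].
by exists w, N, 1%N, C.
Qed.

Lemma chain_child w N k C i : chain w N k C -> (i < k)%N ->
  child S (charvec_of w (N + i) (C i)) (charvec_of w (N + i.+1) (C i.+1)).
Proof.
move=> [netC chC] ik; exists (w (N + i)%N).
have : chain w (N + i) 1 (fun l => C (i + l)%N).
  split => l; rewrite -addnA => lj.
    by apply: netC; rewrite (leq_trans _ ik) // -addn1 leq_add2l.
  rewrite addnS; apply: chC; rewrite (leq_trans _ ik) //.
  by lia.
move/chain_admissible; rewrite /mkseq /= !tailE !addn0 -addnA addn1.
by [].
Qed.

Lemma linked_closed (L : set (@charvec R)) g b :
  (forall g b, L g -> child S g b -> L b) -> L g -> linked g b -> L b.
Proof.
move=> cL + [w [N [k [C [_ ch gE ->]]]]]; rewrite gE => Lg.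
suff h i : (i <= k)%N -> L (charvec_of w (N + i) (C i)) by exact: h.
elim: i => // i IH ik; apply: cL (IH (ltnW ik)) _; exact: chain_child ch ik.
Qed.

(** The vectors reachable from [b] form a loop class because each of them
    leads back to [b].  Any essential class contains [b], being closed under
    children, and all its members are reached from [b]. *)
Lemma essential_classE b :
  (exists w n D, D \in net_intervals w n /\ charvec_of w n D = b) ->
  (forall w n D, D \in net_intervals w n -> linked (charvec_of w n D) b) ->
  essential_class S = [set g | linked b g].
Proof.
move=> [wb [nb [Db [Dn bE]]]] all_b.
have bb : linked b b by rewrite -{1}bE; exact: all_b.
have back g : linked b g -> linked g b.
  by move=> [w [N [k [C [_ [netC _] _ ->]]]]]; apply: all_b; exact: netC.
apply: xget_unique => [|L [[[g Lg] loopL] closedL]].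
  split; last by move=> g c /= bg /child_linked; exact: linked_trans.
  split; first by exists b.
  move=> g c /= bg bc.
  have [w [N [k [C [k0 ch gE cE]]]]] := linked_trans (back _ bg) bc.
  exists (mkseq (tail N w) k).
  exists (behead (mkseq (fun i => charvec_of w (N + i) (C i)) k.+1)).
  have -> : g :: behead (mkseq (fun i => charvec_of w (N + i) (C i)) k.+1) =
      mkseq (fun i => charvec_of w (N + i) (C i)) k.+1 by rewrite gE.
  rewrite size_mkseq; split => //.
  - exact: chain_admissible.
  - rewrite cE gE.
    rewrite -[LHS]/(last g (mkseq (fun i => charvec_of w (N + i) (C i)) k.+1)).
    by rewrite /mkseq -addn1 iotaD map_cat last_cat.
  - move=> d /mapP[i]; rewrite mem_iota add0n ltnS => /andP[_ ik] ->.
    case: i ik => [_|i ik]; first by rewrite -gE.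
    by apply: linked_trans bg _; rewrite gE; apply: chain_linked ch _.
have [w [N [D [Dn' gE]]]] : exists w n D, D \in net_intervals w n /\ charvec_of w n D = g.
  have [nu [l [_ /admissible_chain[w [N [C [[netC _] [gE _]]]]] _ _]]] := loopL _ _ Lg Lg.
  by exists w, (N + 0)%N, (C 0%N); split; [exact: netC|].
have Lb : L b.
  by apply: (linked_closed closedL Lg); rewrite -gE; exact: all_b.
apply/seteqP; split => c /=; last exact: linked_closed.
move=> Lc; have [nu [l [nu0 path_l lastl _]]] := loopL _ _ Lb Lc.
have [w' [N' [C [ch lE]]]] := admissible_chain path_l.
exists w', N', (size nu), C; split => //; first by case: lE.
rewrite -lastl -[LHS]/(last b (b :: l)) lE /mkseq -addn1 iotaD map_cat last_cat.
by [].
Qed.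

End paths.

(** * Copies of a net interval with the most neighbours *)

Section marker.
Context {R : realType} (S : rifs R).
Implicit Types (w : Omega S) (s t u : seq (indexed_letter S)) (x y z : R).
Implicit Types (D E : R * R).
Context (hull01 : forall w, convex_hull (attractor w) = `[0, 1]%classic).

(** The left end of a net interval is [word_map t 0] or [word_map t 1], and the
    offset lies in [0, 1]; so the difference [word_map t 0 - word_map s 0] is
    normalized to at most 1 in absolute value and falls into the finite set. *)
Lemma neighbour_bound : finite_type S ->
  exists B, forall w n D, D \in net_intervals w n ->
    (size (neighbour_set w n D) <= B)%N.
Proof.
move=> [F hF]; exists (size (F ++ map (+%R 1) F)) => w n D Dn.
apply: uniq_leq_size => [|v]; first by rewrite sort_uniq undup_uniq.
have /(netP hull01)[[D1 _ D12 _] _] := Dn.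
move=> /(neighbourP _ _ _ (ltW D12))[s [sw /andP[s0 s1] ->]].
have rn := ratioX_gt0 S n.
have s1E := word_map1 sw.
have v0 : 0 <= offset n D s by rewrite mulr_ge0 ?subr_ge0 // invr_ge0 ltW.
have v1 : offset n D s <= 1.
  by rewrite /offset mulrC ler_pdivrMr // mul1r; lra.
rewrite mem_cat; move/endpointsP: D1 => [t tw [] DE].
- apply/orP; left; case: (hF n w t s tw sw); rewrite -DE /offset mulrC //.
  rewrite -[_ ^- n]gtr0_norm ?invr_gt0 // -normrM -/(offset n D s) ger0_norm //.
  by rewrite ltNge v1.
- apply/orP; right; apply/mapP.
  have vE : offset n D s = 1 + (word_map t 0 - word_map s 0) * ratio S ^- n.
    rewrite /offset DE (word_map1 tw); field.
    by rewrite ratioX_neq0.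
  exists ((word_map t 0 - word_map s 0) * ratio S ^- n) => //.
  case: (hF n w t s tw sw) => //.
  rewrite -[_ ^- n]gtr0_norm ?invr_gt0 // -normrM ltNge ler_norml.
  by move=> /negP; case; apply/andP; split; lra.
Qed.

Definition crowded w n D : Prop := D \in net_intervals w n /\
  forall w' n' D', D' \in net_intervals w' n' ->
    (size (neighbour_set w' n' D') <= size (neighbour_set w n D))%N.

Lemma crowded_exists : finite_type S -> exists w n D, crowded w n D.
Proof.
move=> /neighbour_bound[B hB].
pose P k := `[< exists w n D, D \in net_intervals w n /\
                  size (neighbour_set w n D) = k >].
have exP : exists k, P k.
  pose w : Omega S := fun=> ord0.
  exists (size (neighbour_set w 0 (0, 1))); apply/asboolP.
  by exists w, 0%N, (0, 1); rewrite mem_head.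
have ubP k : P k -> (k <= B)%N.
  by move=> /asboolP[w [n [D [Dn <-]]]]; exact: hB.
case: (ex_maxnP exP ubP) => k /asboolP[w [n [D [Dn <-]]]] kmax.
exists w, n, D; split => // w' n' D' Dn'; apply: kmax; apply/asboolP.
by exists w', n', D'.
Qed.

Definition image_itv s D : R * R := (word_map s D.1, word_map s D.2).

Lemma piece_sub w n D E x : piece w n D -> E.1 \in endpoints w n ->
  E.2 \in endpoints w n -> D.1 <= x <= D.2 -> E.1 < x < E.2 ->
  E.1 <= D.1 /\ D.2 <= E.2.
Proof.
move=> [_ _ _ h] E1 E2 /andP[Dx xD] /andP[Ex xE].
have := h _ E1; rewrite (lt_le_trans Ex xD) andbT -leNgt => ->.
by have := h _ E2; rewrite (le_lt_trans Dx xE) /= -leNgt => ->.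
Qed.

Lemma mkseq_prefix (w w' : Omega S) n m :
  (n <= m)%N -> mkseq w m = mkseq w' m -> mkseq w n = mkseq w' n.
Proof.
by move=> nm /eq_mkseqP h; apply/eq_mkseqP => i lti; apply: h; exact: leq_trans nm.
Qed.

Lemma image_endpoints w N s w0 n D : s \in words w N ->
  mkseq (tail N w) n = mkseq w0 n -> piece w0 n D ->
  (image_itv s D).1 \in endpoints w (N + n) /\
  (image_itv s D).2 \in endpoints w (N + n).
Proof.
move=> sw pre [D1 D2 _ _].
by split; apply: endpoints_word => //; rewrite (endpoints_prefix pre).
Qed.

Lemma image_covers w N s w0 n D t : s \in words w N ->
  mkseq (tail N w) n = mkseq w0 n -> t \in words w0 n -> covers t D ->
  [/\ s ++ t \in words w (N + n), covers (s ++ t) (image_itv s D)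
    & offset (N + n) (image_itv s D) (s ++ t) = offset n D t].
Proof.
move=> sw pre tw /andP[t0 t1]; split.
- by apply: words_cat; rewrite // (words_prefix pre).
- by rewrite /covers !word_map_cat /= !word_map_le t0.
- rewrite /offset word_map_cat /= (word_mapE s D.1).
  rewrite (word_mapE s (word_map t 0)) (size_words sw) exprD; field.
  by rewrite !ratioX_neq0.
Qed.

(** The neighbours of [D] reappear, translated, as neighbours of every
    subinterval [X] of the copy; the list [l] keeps their number. *)
Lemma neighbour_image w N s w0 n D X : s \in words w N ->
  mkseq (tail N w) n = mkseq w0 n -> D.1 < D.2 ->
  (image_itv s D).1 <= X.1 -> X.2 <= (image_itv s D).2 ->
  exists l, [/\ uniq l, size l = size (neighbour_set w0 n D)
    & forall v, v \in l -> exists t, [/\ t \in words w (N + n), covers t X,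
        covers t (image_itv s D) & v = offset (N + n) X t]].
Proof.
move=> sw pre D12 sX Xs.
pose f v := v + ratio S ^- (N + n) * (X.1 - (image_itv s D).1).
exists (map f (neighbour_set w0 n D)); split; first 2 last.
- move=> v /mapP[v0 /(neighbourP _ _ _ (ltW D12))[t [tw tD ->]] ->].
  have [stw stI <-] := image_covers sw pre tw tD.
  exists (s ++ t); split => //; last by rewrite /f /offset; ring.
  have /andP[c1 c2] := stI.
  by rewrite /covers (le_trans c1 sX) (le_trans Xs c2).
- rewrite map_inj_uniq ?sort_uniq ?undup_uniq // => a b.
  exact: addIr.
- by rewrite size_map.
Qed.

Lemma offset_inj n D s t : offset n D s = offset n D t -> word_map s 0 = word_map t 0.
Proof.
rewrite /offset => /(mulfI _) h; have := h ltac:(by rewrite invr_neq0 ?ratioX_neq0).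
by move=> /addrI /oppr_inj.
Qed.

(** A word covering [X] but not the whole copy would be one neighbour more
    than the copies of those of [D], against maximality. *)
Lemma crowded_no_new w N s w0 n D X t : crowded w0 n D -> s \in words w N ->
  mkseq (tail N w) n = mkseq w0 n -> X \in net_intervals w (N + n) ->
  (image_itv s D).1 <= X.1 -> X.2 <= (image_itv s D).2 ->
  t \in words w (N + n) -> covers t X -> covers t (image_itv s D).
Proof.
move=> [Dn Dmax] sw pre Xn sX Xs tw tX.
have /(netP hull01)[pD _] := Dn; have /(netP hull01)[pX _] := Xn.
have X12 := piece_lt pX.
have [l [ul sl hl]] := neighbour_image sw pre (piece_lt pD) sX Xs.
(* An equal offset means an equal basic interval. *)
have [vl|vl] := boolP (offset (N + n) X t \in l).
  have [t' [tw' _ /andP[c1 c2] /offset_inj e]] := hl _ vl.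
  by rewrite /covers (word_map1 tw) e c1 /= -(word_map1 tw').
have := Dmax _ _ _ Xn; rewrite -sl leqNgt => /negP; case.
rewrite -[_.+1]/(size (offset (N + n) X t :: l)); apply: uniq_leq_size.
  by rewrite /= vl.
move=> v; rewrite inE => /predU1P[->|/hl[t' [tw' tX' _ ->]]].
  by apply/(neighbourP _ _ _ (ltW X12)); exists t.
by apply/(neighbourP _ _ _ (ltW X12)); exists t'.
Qed.

(** If an endpoint [c] of [word_map t] lay inside the copy, the net interval
    adjacent to [c] on the inner side of [word_map t] would be covered by [t],
    although [t] does not cover the copy. *)
Lemma crowded_image w N s w0 n D : crowded w0 n D -> s \in words w N ->
  mkseq (tail N w) n = mkseq w0 n -> hits w (image_itv s D) ->
  image_itv s D \in net_intervals w (N + n) /\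
  same_type w0 n D w (N + n) (image_itv s D).
Proof.
move=> cD sw pre hD; have [Dn Dmax] := cD; have /(netP hull01)[pD _] := Dn.
have [e1 e2] := image_endpoints sw pre pD.
have D12 : (image_itv s D).1 < (image_itv s D).2.
  by rewrite word_map_lt; exact: piece_lt pD.
have pI : piece w (N + n) (image_itv s D).
  split => // c cE; apply/negP => cD12.
  have c01 := endpoints_itv hull01 cE; have /andP[c1 c2] := cD12.
  have i1 := endpoints_itv hull01 e1; have i2 := endpoints_itv hull01 e2.
  have [t tw ct] := (endpointsP _ _ _).1 cE.
  have t01 : word_map t 0 < word_map t 1 by rewrite word_map_lt ltr01.
  suff : covers t (image_itv s D).
    by move=> /andP[h0 h1]; case: ct => cE'; [move: c1|move: c2];
      rewrite cE' ltNge ?h0 ?h1.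
  have e_t0 : word_map t 0 \in endpoints w (N + n).
    by apply/endpointsP; exists t; auto.
  have e_t1 : word_map t 1 \in endpoints w (N + n).
    by apply/endpointsP; exists t; auto.
  case: ct => cE'.
  (* c is a left end: the net interval on its right is covered by t. *)
  - have [|X pX /andP[Xc cX]] := @piece_right _ _ hull01 w (N + n) c.
      by case/andP: c01 => -> _ /=; case/andP: i2 => _; exact: lt_le_trans.
    have cX' : c <= X.1.
      by have [_ _ _ /(_ c cE)] := pX; rewrite cX andbT -leNgt.
    have /eqP cX1 : c == X.1 by rewrite eq_le cX' Xc.
    have [X1 X2] : (image_itv s D).1 <= X.1 /\ X.2 <= (image_itv s D).2.
      by apply: (piece_sub pX e1 e2 _ cD12); rewrite Xc ltW.
    apply: (crowded_no_new cD sw pre _ X1 X2 tw).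
      apply/(netP hull01); split => //.
      have [|y Ky] := attractor_right_limit0 hull01 tw (e := X.2 - c).
        by rewrite subr_gt0.
      rewrite -cE' [c + _]addrC subrK => /andP[cy yX].
      by exists y; rewrite // yX andbT -cX1.
    rewrite /covers -cE' cX' /=.
    have [_ _ _ /(_ _ e_t1)] := pX; rewrite (le_lt_trans Xc) ?cE' //= -leNgt.
    by [].
  (* c is a right end: the net interval on its left is covered by t. *)
  - have [|X pX /andP[Xc cX]] := @piece_left _ _ hull01 w (N + n) c.
      case/andP: c01 => _ -> /=; case/andP: i1 => i1 _.
      by rewrite andbT; exact: le_lt_trans c1.
    have cX' : X.2 <= c.
      by have [_ _ _ /(_ c cE)] := pX; rewrite Xc /= -leNgt.
    have /eqP cX1 : c == X.2 by rewrite eq_le cX' cX.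
    have [X1 X2] : (image_itv s D).1 <= X.1 /\ X.2 <= (image_itv s D).2.
      by apply: (piece_sub pX e1 e2 _ cD12); rewrite cX ltW.
    apply: (crowded_no_new cD sw pre _ X1 X2 tw).
      apply/(netP hull01); split => //.
      have [|y Ky] := attractor_left_limit1 hull01 tw (e := c - X.1).
        by rewrite subr_gt0.
      rewrite -cE' opprB [c + _]addrC subrK => /andP[cy yX].
      by exists y; rewrite // cy -cX1.
    rewrite /covers -cE' cX' andbT.
    have [_ _ _ /(_ _ e_t0)] := pX.
    by rewrite (lt_le_trans _ cX) ?cE' // andbT -leNgt.
have nI : image_itv s D \in net_intervals w (N + n) by apply/(netP hull01).
split => //; split.
  rewrite /normalized_length /= (word_mapE s D.2) (word_mapE s D.1).
  by rewrite (size_words sw) exprD; field; rewrite !ratioX_neq0.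
have sub : {subset neighbour_set w0 n D <= neighbour_set w (N + n) (image_itv s D)}.
  move=> v /(neighbourP _ _ _ (ltW (piece_lt pD)))[t [tw tD ->]].
  have [stw stI <-] := image_covers sw pre tw tD.
  by apply/(neighbourP _ _ _ (ltW D12)); exists (s ++ t).
have un : uniq (neighbour_set w0 n D) by rewrite sort_uniq undup_uniq.
have [_ eqV] := uniq_min_size un sub (Dmax _ _ _ nI).
by apply: lt_sorted_eq; rewrite ?neighbour_sorted.
Qed.

(** Wherever the letters of [m] follow a word [s], the copy of [D] is a net
    interval of vector [b] whose interior contains the basic interval of
    [s ++ m]. *)
Definition marker (m : seq (indexed_letter S)) n D b : Prop :=
  [/\ (0 < n <= size m)%N, 0 <= D.1, D.2 <= 1
    & forall w N s, s \in words w N -> mkseq (tail N w) (size m) = map tag m ->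
      [/\ image_itv s D \in net_intervals w (N + n),
          charvec_of w (N + n) (image_itv s D) = b,
          (image_itv s D).1 < word_map (s ++ m) 0
        & word_map (s ++ m) 1 < (image_itv s D).2] ].

Lemma small_word w n x D : attractor w x -> D.1 < x < D.2 ->
  exists N s, [/\ (n <= N)%N, s \in words w N, D.1 < word_map s 0
    & word_map s 1 < D.2].
Proof.
move=> Kx /andP[Dx xD].
have [|N nN] := @ratioX_lt _ S (Num.min (x - D.1) (D.2 - x)) n.
  by rewrite lt_min !subr_gt0 Dx.
rewrite lt_min => /andP[N1 N2].
have [s sw [y /(attractor01 hull01)/andP[y0 y1] xE]] := attractor_decomp hull01 N Kx.
have s1 := word_map1 sw.
have x0 : word_map s 0 <= x by rewrite xE word_map_le.
have x1 : x <= word_map s 1 by rewrite xE word_map_le.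
by exists N, s; split => //; lra.
Qed.

(** [b] is the vector of a child of the crowded interval, since the rank of a
    copy of the crowded interval itself also depends on neighbouring intervals
    that are not copies.  Requiring a
    basic interval inside the child ensures that the copies meet the attractor. *)
Lemma marker_exists : finite_type S -> exists m n D b, marker m n D b /\
  exists w n' D', D' \in net_intervals w n' /\ charvec_of w n' D' = b.
Proof.
move=> /crowded_exists[w0 [n0 [D0 cD]]]; have [Dn Dmax] := cD.
have /(netP hull01)[pD [x0 Kx0 x0D]] := Dn.
have [C [netC Cx chC]] := chain_exists hull01 Kx0.
have D0E : C n0 = D0.
  have /(netP hull01)[pC _] := netC n0.
  exact: (piece_unique pC pD (Cx _) x0D).
pose D1 := C n0.+1.
have D1n : D1 \in net_intervals w0 n0.+1 by exact: netC.
have D1c : D1 \in children w0 n0 D0 by rewrite -D0E; exact: chC.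
have /(netP hull01)[pD1 [x1 Kx1 x1D]] := D1n.
have [M [m [nM mw m0 m1]]] := small_word n0.+1 Kx1 x1D.
have sM := size_words mw.
exists m, n0.+1, D1, (charvec_of w0 n0.+1 D1); split; last by exists w0, n0.+1, D1.
have [e1 e2 _ _] := pD1.
split.
- by rewrite sM nM.
- by have /andP[] := endpoints_itv hull01 e1.
- by have /andP[] := endpoints_itv hull01 e2.
move=> w N s sw; rewrite (wordsP mw) sM => pre.
have pre0 : mkseq (tail N w) n0 = mkseq w0 n0 by apply: mkseq_prefix pre; exact: ltnW.
have smw : s ++ m \in words w (N + M).
  by apply: words_cat; rewrite // (words_prefix pre).
have a1 : (image_itv s D1).1 < word_map (s ++ m) 0 by rewrite word_map_cat word_map_lt.
have a2 : word_map (s ++ m) 1 < (image_itv s D1).2 by rewrite word_map_cat word_map_lt.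
have h1 : hits w (image_itv s D1).
  exists (word_map (s ++ m) 0).
    exact: (attractor_word hull01 smw (attractor_0 hull01 _)).
  by rewrite a1 (le_lt_trans _ a2) // word_map_le ler01.
have [_ [c1 c2]] := (childrenP hull01 _ _ _ _).1 D1c.
have h0 : hits w (image_itv s D0).
  have [x Kx /andP[x1' x2']] := h1; exists x => //.
  rewrite (le_lt_trans _ x1') ?word_map_le //=.
  by rewrite (lt_le_trans x2') ?word_map_le.
have [nI st] := crowded_image cD sw pre0 h0.
have /(netP hull01)[pI _] := nI.
have tw : twins w0 n0 D0 w (N + n0) (image_itv s D0).
  by split => //; have /eq_mkseqP/(_ n0 nM) := pre; rewrite tailE.
have rE : rescale_itv S n0 D0 (N + n0) (image_itv s D0) D1 = image_itv s D1.
  have h x : rescale S n0 D0 (N + n0) (image_itv s D0) x = word_map s x.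
    rewrite /rescale /= (word_mapE s x) (word_mapE s D0.1) (size_words sw) exprD.
    by field; rewrite ratioX_neq0.
  by rewrite /rescale_itv !h.
have [|] := transfer hull01 tw Dn nI D1c; first by rewrite rE.
by rewrite rE addnS => /(childrenP hull01)[].
Qed.

Section with_marker.
Context (m : seq (indexed_letter S)) (n : nat) (D1 : R * R) (b : @charvec R).
Context (mD : marker m n D1 b).

Lemma marker_sub s : word_map s 0 <= (image_itv s D1).1 /\
  (image_itv s D1).2 <= word_map s 1.
Proof. by have [_ D0 D2 _] := mD; rewrite !word_map_le. Qed.

(** Below a given net interval pick a basic interval and prescribe the letters
    of the marker after it; the chain through a point of the resulting copy
    passes through both intervals. *)
Lemma marker_linked w k D : D \in net_intervals w k ->
  linked S (charvec_of w k D) b.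
Proof.
have [/andP[n0 nm] _ _ hm] := mD.
have later N : (k <= N)%N -> (k < N + n)%N.
  by move=> kN; rewrite -[k.+1]addn1; exact: leq_add.
move=> Dk; have /(netP hull01)[pD [x Kx xD]] := Dk.
have [N [s [kN sw s0 s1]]] := small_word k Kx xD.
case: (m) nm hm => [|a m'] nm hm; first by move: n0; rewrite ltnNge nm.
(* The letters after the marker are arbitrary: the default value gives them. *)
pose w0 : Omega S := fun i => tag (nth a (a :: m') i).
pose w' := splice w N w0.
have pre : mkseq (tail N w') (size (a :: m')) = map tag (a :: m').
  rewrite splice_tail; apply: (@eq_from_nth _ (tag a)); rewrite size_mkseq ?size_map //.
  by move=> i lti; rewrite nth_mkseq // (nth_map a).
have sw' : s \in words w' N by rewrite (words_prefix (splice_prefix w w0 (leqnn N))).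
have [En Eb E0 E1] := hm w' N s sw' pre.
have [sE1 sE2] := marker_sub s; set E := image_itv s D1 in En Eb sE1 sE2.
have /(netP hull01)[pE [y Ky yE]] := En.
have yD : D.1 < y < D.2.
  have /andP[y1 y2] := yE.
  by rewrite (lt_trans s0) ?(le_lt_trans sE1) //= (lt_trans _ s1) // (lt_le_trans y2).
have [Dk' De] : D \in net_intervals w' k /\ charvec_of w' k D = charvec_of w k D.
  apply: (prefix_change hull01) Dk _; last by exists y.
  by rewrite splice_prefix.
have [C [netC Cx chC]] := chain_exists hull01 Ky.
have CD : C k = D.
  have /(netP hull01)[pC _] := netC k; have /(netP hull01)[pD' _] := Dk'.
  exact: (piece_unique pC pD' (Cx _) yD).
have CE : C (N + n)%N = E.
  have /(netP hull01)[pC _] := netC (N + n)%N.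
  exact: (piece_unique pC pE (Cx _) yE).
rewrite -De -CD -Eb -CE.
have : chain w' 0 (N + n) C by split => i _; rewrite add0n //.
by move/chain_linked; apply; rewrite (later _ kN) leqnn.
Qed.

Context (b_real : exists w n' D', D' \in net_intervals w n' /\ charvec_of w n' D' = b).

Lemma marker_essential w N s y : s \in words w N ->
  mkseq (tail N w) (size m) = map tag m -> 0 <= y <= 1 ->
  attractor w (word_map (s ++ m) y) -> essential_point w (word_map (s ++ m) y).
Proof.
move=> sw pre /andP[y0 y1] Kx; have [_ _ _ hm] := mD.
have [En Eb E0 E1] := hm w N s sw pre.
set E := image_itv s D1 in En Eb E0 E1; set x := word_map _ _ in Kx *.
have xE : E.1 < x < E.2.
  by rewrite (lt_le_trans E0) ?word_map_le //= (le_lt_trans _ E1) ?word_map_le.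
have /(netP hull01)[pE _] := En.
have [C [netC Cx chC]] := chain_exists hull01 Kx.
have CE : C (N + n)%N = E.
  have /(netP hull01)[pC _] := netC (N + n)%N.
  exact: (piece_unique pC pE (Cx _) xE).
exists (fun j => charvec_of w j (C j)).
  exists C; split => //; first by have := netC 0%N; rewrite inE => /eqP.
  by move=> j; split => //; rewrite /citv /= in_itv; exact: Cx.
exists (N + n)%N => j; rewrite (essential_classE hull01 b_real marker_linked) /=.
rewrite leq_eqVlt => /predU1P[<-|Jj].
  by rewrite CE Eb; have := marker_linked En; rewrite Eb.
rewrite -Eb -CE.
have : chain w 0 j C by split => i _; rewrite add0n //.
by move/chain_linked; apply; rewrite Jj leqnn.
Qed.

End with_marker.
End marker.

(** * Mass of the points whose coding misses the marker *)

Lemma geometric_le0 (R : realType) (a : R) (e : \bar R) : 0 <= a < 1 -> (0 <= e)%E ->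
  (forall k, (e <= (a ^+ k)%:E)%E) -> e = 0%E.
Proof.
move=> /andP[a0 a1]; case: e => [e| |] //; last by move=> _ /(_ 0%N).
rewrite lee_fin => e0 h; congr _%:E; apply/eqP; rewrite eq_le e0 andbT.
apply: contraT; rewrite -ltNge => {}e0.
have : (fun k => a ^+ k) @ \oo --> (0 : R).
  by apply: cvg_expr; rewrite ger0_norm.
move/cvgrPdist_lt => /(_ e e0) [N _ /(_ N (leqnn N))] /=.
rewrite sub0r normrN ger0_norm ?exprn_ge0 //.
by have := h N; rewrite lee_fin leNgt => /negbTE ->.
Qed.

Section measures.
Context {R : realType} (S : rifs R).
Implicit Types (w : Omega S) (s t u : seq (indexed_letter S)) (x y z : R).
Context (hull01 : forall w, convex_hull (attractor w) = `[0, 1]%classic).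

Section self_similar.
Context (p : forall j : letter S, index_set j -> R)
  (mu : Omega S -> probability (measurableTypeR R) R).
Context (p_gt0 : forall (j : letter S) (k : index_set j), 0 < p k).
Context (p_sum : forall j : letter S, \sum_(k : index_set j) p k = 1).
Context (mu_ss : is_random_self_similar p mu).

Lemma measurable_sim (j : letter S) (k : index_set j) (A : set R) :
  measurable A -> measurable (sim k @^-1` A).
Proof.
move=> mA; rewrite -[X in measurable X]setTI.
suff : measurable_fun setT (sim k) by apply.
apply: continuous_measurable_fun => x; apply: cvgD; last exact: cvg_cst.
by apply: cvgM; [exact: cvg_cst|exact: cvg_id].
Qed.

Lemma measurable_word s (A : set R) :
  measurable A -> measurable (word_map s @^-1` A).
Proof. by elim: s A => // a s IH A mA; exact: (IH _ (measurable_sim (tagged a) mA)). Qed.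

Lemma mu_le_words n w (A : set R) (c : R) : measurable A ->
  (forall s, s \in words w n -> (mu (tail n w) (word_map s @^-1` A) <= c%:E)%E) ->
  (mu w A <= c%:E)%E.
Proof.
elim: n w A => [|n IH] w A mA h; first by apply: (h [::]); rewrite mem_head.
have [_ ->] := mu_ss w; last exact: mA.
rewrite -[c]mul1r -(p_sum (w 0%N)) mulr_suml -sumEFin.
apply: lee_sum => k _; rewrite EFinM lee_pmul2l // ?lte_fin //.
apply: IH => [|s sw]; first exact: measurable_sim.
rewrite tail_shift; apply: (h (existT _ (w 0%N) k :: s)).
by apply/allpairsPdep; exists k, s; rewrite mem_enum.
Qed.

Definition word_weight s : R := \prod_(a <- s) p (tagged a).

Lemma word_weight_gt0 s : 0 < word_weight s.
Proof. by apply: prodr_gt0 => a _; exact: p_gt0. Qed.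

Lemma word_weight_le1 s : word_weight s <= 1.
Proof.
apply: prodr_ile1 => -[j k] _ /=; rewrite ltW ?p_gt0 //=.
by rewrite -(p_sum j) (bigD1 k) //= lerDl sumr_ge0 // => i _; rewrite ltW.
Qed.

(** Among the words of this length, [s] carries the proportion [word_weight s] of
    the mass and contributes nothing; the estimate is obtained one letter at a
    time. *)
Lemma mu_avoid s w (A : set R) (c : R) : 0 <= c -> s \in words w (size s) ->
  measurable A -> (forall x, 0 <= x <= 1 -> ~ A (word_map s x)) ->
  (forall t, t \in words w (size s) ->
     (mu (tail (size s) w) (word_map t @^-1` A) <= c%:E)%E) ->
  (mu w A <= ((1 - word_weight s) * c)%:E)%E.
Proof.
move=> c0; elim: s w A => [|a s IH] w A.
  move=> _ mA nA _; rewrite /word_weight big_nil subrr mul0r.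
  have [K0 _] := mu_ss w.
  suff : (mu w A <= mu w (~` attractor w))%E by rewrite K0.
  apply: le_measure; rewrite ?inE //.
    apply: measurableC; apply: closed_measurable; exact: attractor_closed.
  move=> x Ax Kx; exact: (nA _ (attractor01 hull01 Kx)).
move=> /allpairsPdep[k [s' [_ + [-> sE]]]]; rewrite -sE => sw mA nA h.
rewrite (mu_ss w).2 //.
pose B k' : R := if k' == k then (1 - word_weight s) * c else c.
have hB k' : (mu (shift w) (sim k' @^-1` A) <= (B k')%:E)%E.
  rewrite /B; case: eqP => [->|_].
    apply: IH => //.
    - exact: measurable_sim.
    - move=> t tw; rewrite tail_shift; apply: (h (existT _ (w 0%N) k :: t)).
      by apply/allpairsPdep; exists k, t; rewrite mem_enum.
  apply: (@mu_le_words (size s)) => [|t tw]; first exact: measurable_sim.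
  rewrite tail_shift; apply: (h (existT _ (w 0%N) k' :: t)).
  by apply/allpairsPdep; exists k', t; rewrite mem_enum.
have -> : (1 - word_weight (existT _ (w 0%N) k :: s)) * c =
    \sum_(k' : index_set (w 0%N)) p k' * B k'.
  rewrite (bigD1 k) //= /B eqxx (eq_bigr (fun k' => p k' * c)); last first.
    by move=> k' /negbTE ->.
  rewrite -mulr_suml /word_weight big_cons /=.
  have := p_sum (w 0%N); rewrite (bigD1 k) //= => /(canRL (addKr _)) ->.
  by ring.
rewrite -sumEFin; apply: lee_sum => k' _.
by rewrite EFinM lee_pmul2l // ?lte_fin.
Qed.

Section marker_mass.
Context (m : seq (indexed_letter S)).

Definition occurs w N : Prop := mkseq (tail N w) (size m) = map tag m.

Definition marked w : set R := \bigcup_(N in [set N | occurs w N])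
  \bigcup_(s in [set` words w N]) citv (word_map (s ++ m) 0, word_map (s ++ m) 1).

Lemma marked_measurable w : measurable (marked w).
Proof.
apply: bigcup_measurable => N _; apply: fin_bigcup_measurable => // s _.
exact: measurable_itv.
Qed.

Lemma marked_tail w n s : s \in words w n ->
  marked (tail n w) `<=` word_map s @^-1` marked w.
Proof.
move=> sw x [N ON [t tw]]; rewrite /citv /= in_itv /= => /andP[x0 x1].
exists (n + N)%N; first by rewrite /= /occurs -tailD.
exists (s ++ t); first exact: words_cat.
by rewrite /citv /= in_itv /= -catA !(word_map_cat s) !word_map_le x0.
Qed.

Lemma unmarked_tail w n s : s \in words w n ->
  (mu (tail n w) (word_map s @^-1` (~` marked w)) <=
   mu (tail n w) (~` marked (tail n w)))%E.
Proof.
move=> sw; apply: le_measure; rewrite ?inE.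
- apply: measurable_word; apply: measurableC; exact: marked_measurable.
- apply: measurableC; exact: marked_measurable.
- by move=> x /= nx /(marked_tail sw).
Qed.

Lemma occurs_mem w : occurs w 0 -> m \in words w (size m).
Proof. by rewrite /occurs mem_words => <-. Qed.

(** The unmarked mass of [w] is at most that of any tail, and an occurrence at
    the start gains the factor [1 - word_weight m]. *)
Lemma unmarked_decay k w : (forall n, exists2 i, (n <= i)%N & occurs w i) ->
  (mu w (~` marked w) <= ((1 - word_weight m) ^+ k)%:E)%E.
Proof.
have q1 : 0 <= 1 - word_weight m by rewrite subr_ge0 word_weight_le1.
have mM w' : measurable (~` marked w').
  by apply: measurableC; exact: marked_measurable.
elim: k w => [|k IH] w io; first by rewrite expr0; apply: probability_le1; exact: mM.
have [i _ Oi] := io 0%N.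
apply: (@mu_le_words i) => // s sw; apply: le_trans (unmarked_tail sw) _.
have Oi' : occurs (tail i w) 0 by [].
rewrite exprS; apply: mu_avoid => //.
- exact: exprn_ge0.
- exact: occurs_mem.
- move=> x /andP[x0 x1]; apply; exists 0%N => //; exists [::] => //.
  by rewrite /citv /= in_itv /= !word_map_le x0.
move=> t tw; apply: le_trans (unmarked_tail tw) _; apply: IH => n.
have [j nj Oj] := io (i + size m + n)%N.
exists (j - (i + size m))%N; first by rewrite leq_subRL // (leq_trans _ nj) ?leq_addr.
by rewrite /occurs !tailD addnA subnKC // (leq_trans _ nj) ?leq_addr.
Qed.

Lemma unmarked_null w : (forall n, exists2 i, (n <= i)%N & occurs w i) ->
  mu w (~` marked w) = 0%E.
Proof.
move=> io; apply: (@geometric_le0 _ (1 - word_weight m)) => [| |k].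
- by rewrite subr_ge0 word_weight_le1 ltrBlDr ltrDl word_weight_gt0.
- exact: measure_ge0.
- exact: unmarked_decay.
Qed.

End marker_mass.
End self_similar.

End measures.

(** * A block of letters recurs almost surely *)

Section bernoulli.
Context {R : realType} (S : rifs R).
Implicit Types (w : Omega S) (u v t : seq (letter S)).
Context (theta : letter S -> R) (P : probability (sequence_space S) R).
Context (theta_gt0 : forall j, 0 < theta j).
Context (theta_sum : \sum_(j : letter S) theta j = 1).
Context (P_bernoulli : is_bernoulli theta P).

Definition letter_weight u : R := \prod_(j <- u) theta j.

Lemma letter_weight_gt0 u : 0 < letter_weight u.
Proof. by apply: prodr_gt0. Qed.

Lemma letter_weight_le1 u : letter_weight u <= 1.
Proof.
apply: prodr_ile1 => j _; rewrite ltW //=.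
by rewrite -theta_sum (bigD1 j) //= lerDl sumr_ge0 // => i _; rewrite ltW.
Qed.

Lemma mkseq_rcons w n : mkseq w n.+1 = rcons (mkseq w n) (w n).
Proof. by rewrite -addn1 mkseqD cats1 /= tailE addn0. Qed.

Lemma measurable_cylinder u : measurable (@cylinder R S u : set (sequence_space S)).
Proof. by apply: sub_sigma_algebra; exists u. Qed.

Lemma cylinder_rcons v w :
  cylinder v w -> cylinder (rcons v (w (size v))) w.
Proof. by rewrite /cylinder /= size_rcons mkseq_rcons => ->. Qed.

Lemma cylinder_rcons_inv v j w :
  cylinder (rcons v j) w -> cylinder v w /\ w (size v) = j.
Proof. by rewrite /cylinder /= size_rcons mkseq_rcons => /rcons_inj[-> ->]. Qed.

Lemma cylinder_sum v (A : set (sequence_space S)) : measurable A ->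
  P (cylinder v `&` A) = (\sum_(j : letter S) P (cylinder (rcons v j) `&` A))%E.
Proof.
move=> mA.
have -> : cylinder v `&` A =
    \big[setU/set0]_(j < (nletter S).+1) (cylinder (rcons v (j : letter S)) `&` A).
  rewrite -bigcup_seq; apply/seteqP; split=> w.
    move=> [vw Aw]; exists (w (size v)); first by rewrite /= mem_index_enum.
    by split => //; exact: cylinder_rcons.
  by move=> [j _ [/cylinder_rcons_inv[]]].
apply: measure_bigsetU_ord => [j|].
  by apply: measurableI => //; exact: measurable_cylinder.
move=> i j _ _ [w [[/cylinder_rcons_inv[_ <-] _] [/cylinder_rcons_inv[_ h] _]]].
exact: h.
Qed.

Lemma cylinder_le n v (A : set (sequence_space S)) (c : R) : measurable A ->
  (forall t, size t = n ->
    (P (cylinder (v ++ t) `&` A) <= (letter_weight (v ++ t) * c)%:E)%E) ->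
  (P (cylinder v `&` A) <= (letter_weight v * c)%:E)%E.
Proof.
elim: n v => [|n IH] v mA h; first by have := h [::] erefl; rewrite cats0.
rewrite cylinder_sum // -[c]mul1r -theta_sum mulr_suml mulr_sumr -sumEFin.
apply: lee_sum => j _; rewrite mulrA.
have -> : letter_weight v * theta j = letter_weight (rcons v j).
  by rewrite /letter_weight -cats1 big_cat big_seq1.
apply: IH => // t tn; rewrite cat_rcons; apply: h.
by rewrite /= tn.
Qed.

(** The counterpart of [mu_avoid] for the Bernoulli measure. *)
Lemma cylinder_avoid u v (A : set (sequence_space S)) (c : R) : 0 <= c ->
  measurable A -> cylinder (v ++ u) `&` A = set0 ->
  (forall t, size t = size u ->
    (P (cylinder (v ++ t) `&` A) <= (letter_weight (v ++ t) * c)%:E)%E) ->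
  (P (cylinder v `&` A) <= (letter_weight v * ((1 - letter_weight u) * c))%:E)%E.
Proof.
move=> c0 mA; elim: u v => [|a u IH] v.
  rewrite cats0 => -> _; rewrite measure0 /letter_weight big_nil subrr mul0r.
  by rewrite mulr0.
move=> Au h; rewrite cylinder_sum //.
pose B j : R := if j == a then (1 - letter_weight u) * c else c.
have wE j : letter_weight (rcons v j) = letter_weight v * theta j.
  by rewrite /letter_weight -cats1 big_cat big_seq1.
have hB j : (P (cylinder (rcons v j) `&` A) <= (letter_weight (rcons v j) * B j)%:E)%E.
  rewrite /B; case: eqP => [->|_].
    by apply: IH => [|t tu]; rewrite cat_rcons //; apply: h; rewrite /= tu.
  apply: (@cylinder_le (size u)) => // t tu; rewrite cat_rcons; apply: h.
  by rewrite /= tu.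
have -> : letter_weight v * ((1 - letter_weight (a :: u)) * c) =
    \sum_(j : letter S) letter_weight (rcons v j) * B j.
  rewrite (eq_bigr (fun j => letter_weight v * (theta j * B j))); last first.
    by move=> j _; rewrite wE mulrA.
  rewrite -mulr_sumr; congr (_ * _).
  rewrite (bigD1 a) //= /B eqxx (eq_bigr (fun j => theta j * c)); last first.
    by move=> j /negbTE ->.
  rewrite -mulr_suml /letter_weight big_cons /=.
  have := theta_sum; rewrite (bigD1 a) //= => /(canRL (addKr _)) ->.
  by ring.
by rewrite -sumEFin; apply: lee_sum => j _; exact: hB.
Qed.

Section recurrence.
Context (u : seq (letter S)).

(** The block is only looked for at disjoint positions, where its occurrences
    are independent. *)
Definition misses n k : set (sequence_space S) :=
  [set w | forall i, (i < k)%N -> mkseq (tail (n + i * size u) w) (size u) <> u].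

Lemma measurable_occurs n :
  measurable ([set w | mkseq (tail n w) (size u) = u] : set (sequence_space S)).
Proof.
rewrite (_ : [set w | _] = \bigcup_(t : n.-tuple (letter S)) cylinder (t ++ u)).
  apply: fin_bigcup_measurable => [|t _]; first exact: finite_finset.
  exact: measurable_cylinder.
apply/seteqP; split => w /=.
  move=> wu; exists [tuple of mkseq w n] => //=.
  by rewrite /cylinder /= size_cat size_mkseq mkseqD wu.
move=> [t _]; rewrite /cylinder /= size_cat mkseqD size_tuple => /eqP.
by rewrite eqseq_cat ?size_mkseq ?size_tuple // => /andP[_ /eqP].
Qed.

Lemma measurable_misses n k : measurable (misses n k).
Proof.
rewrite (_ : misses n k = \bigcap_(i in `I_k)
    ~` [set w | mkseq (tail (n + i * size u) w) (size u) = u]).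
  apply: bigcap_measurableType => i _; apply: measurableC.
  exact: measurable_occurs.
by apply/seteqP; split => w h i ik; exact: h.
Qed.

Lemma misses_cylinder k v :
  (P (cylinder v `&` misses (size v) k) <=
    (letter_weight v * (1 - letter_weight u) ^+ k)%:E)%E.
Proof.
elim: k v => [|k IH] v.
  rewrite expr0 mulr1 -P_bernoulli; apply: le_measure; rewrite ?inE //.
  - by apply: measurableI; [exact: measurable_cylinder|exact: measurable_misses].
  - exact: measurable_cylinder.
rewrite exprS; apply: cylinder_avoid.
- by rewrite exprn_ge0 // subr_ge0 letter_weight_le1.
- exact: measurable_misses.
- apply/seteqP; split => w //=; rewrite /cylinder /= size_cat mkseqD.
  move=> [/eqP + h]; rewrite eqseq_cat ?size_mkseq // => /andP[_ /eqP].
  by have := h 0%N isT; rewrite mul0n addn0.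
- move=> t tu; apply: le_trans (IH _); apply: le_measure; rewrite ?inE.
  + by apply: measurableI; [exact: measurable_cylinder|exact: measurable_misses].
  + by apply: measurableI; [exact: measurable_cylinder|exact: measurable_misses].
  + move=> w [cw h]; split => // i ik.
    by have := h i.+1 ik; rewrite size_cat tu mulSn addnA.
Qed.

Lemma recurrence : P.-negligible
  [set w | ~ forall n, exists2 i, (n <= i)%N & mkseq (tail i w) (size u) = u].
Proof.
apply: (@negligibleS _ _ _ _ (\bigcup_n \bigcap_k misses n k)).
  move=> w /= /existsNP[n h]; exists n => // k _ i ik e; apply: h.
  by exists (n + i * size u)%N; rewrite ?leq_addr.
apply: negligible_bigcup => n.
have mB : measurable (\bigcap_k misses n k).
  by apply: bigcap_measurableType => k _; exact: measurable_misses.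
apply/negligibleP => //.
apply: (@geometric_le0 _ (1 - letter_weight u)) => [| |k].
- by rewrite subr_ge0 letter_weight_le1 ltrBlDr ltrDl letter_weight_gt0.
- exact: measure_ge0.
- have -> : (1 - letter_weight u) ^+ k =
      letter_weight [::] * (1 - letter_weight u) ^+ k.
    by rewrite /letter_weight big_nil mul1r.
  have le1 : (P (\bigcap_k misses n k) <= P (cylinder [::] `&` misses n k))%E.
    apply: le_measure; rewrite ?inE //; last by move=> w h; split => //; exact: h.
    by apply: measurableI; [exact: measurable_cylinder|exact: measurable_misses].
  apply: le_trans le1 _; apply: (@cylinder_le n).
    exact: measurable_misses.
  by move=> t <-; exact: misses_cylinder.
Qed.

End recurrence.
End bernoulli.

(** * Almost every point is essential *)

Theorem proposition4p21 (R : realType) (S : rifs R)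
    (theta : letter S -> R) (P : probability (sequence_space S) R)
    (p : forall j : letter S, index_set j -> R)
    (mu : Omega S -> probability (measurableTypeR R) R)
    (theta_gt0 : forall j, 0 < theta j)
    (theta_sum : \sum_(j : letter S) theta j = 1)
    (P_bernoulli : is_bernoulli theta P)
    (hull01 : forall w : Omega S, convex_hull (attractor w) = `[0, 1]%classic)
    (S_finite_type : finite_type S)
    (p_gt0 : forall (j : letter S) (k : index_set j), 0 < p j k)
    (p_sum : forall j : letter S, \sum_(k : index_set j) p j k = 1)
    (mu_self_similar : is_random_self_similar p mu) :
  {ae P, forall w : Omega S, (mu w).-negligible (nonessential_points w)}.
Proof.
have [m [n [D [b [mD b_real]]]]] := marker_exists hull01 S_finite_type.
apply: negligibleS (recurrence theta_gt0 theta_sum P_bernoulli (map tag m)).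
move=> w /= h io; apply: h.
have occ k : exists2 i, (k <= i)%N & occurs m w i.
  by have [i ki] := io k; rewrite size_map => e; exists i.
exists (~` marked m w); split.
- by apply: measurableC; exact: marked_measurable.
- exact: (unmarked_null hull01 p_gt0 p_sum mu_self_similar occ).
move=> x [Kx nx] [N ON [s sw]]; rewrite /citv /= in_itv /= => /andP[x0 x1].
apply: nx.
have r0 := ratioX_gt0 S (size (s ++ m)).
pose y := (x - word_map (s ++ m) 0) / ratio S ^+ size (s ++ m).
have xE : word_map (s ++ m) y = x.
  by rewrite word_mapE /y mulrC divfK ?lt0r_neq0 // subrK.
rewrite -xE; apply: (marker_essential hull01 mD b_real sw ON); last by rewrite xE.
by rewrite -(word_map_le (s ++ m) 0) -(word_map_le (s ++ m) y 1) xE x0.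
Qed.
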